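(* Let $\Omega$ be a strongly homogeneous current of bidegree $(p,p)$ on $\mathbb R^n\setminus\{0\}$. Then $\Omega$ is strong and homogeneous of order zero, i.e. invariant under scaling in the $x$-variable: $F_t^*(\Omega)=\Omega$ for all $t>0$, where $F_t(x,\xi)=(tx,\xi)$.
   Context: A superform of bidegree $(p,q)$ on an open set $U\subset\mathbb R^n$ is a form $\alpha=\sum_{|I|=p,|K|=q}\alpha_{IK}(x)\,dx_I\wedge d\xi_K$ on $U\times\mathbb R^n_\xi$ whose coefficients depend only on $x$; $d$ is the exterior derivative. The superintegral is normalized by $\int f\,dx_1\wedge d\xi_1\wedge\dots\wedge dx_n\wedge d\xi_n=\int f\,dx$. A current of bidegree $(p,q)$ is a continuous linear functional on smooth compactly supported superforms of bidegree $(n-p,n-q)$, written $\sum\Omega_{IK}dx_I\wedge d\xi_K$ with action written $\int\Omega\wedge\alpha$; currents have measure coefficients. A $(p,p)$-form or current is symmetric if $\Omega_{IK}=\Omega_{KI}$ for increasing $I,K$. A current $\Omega$ of bidegree $(p,p)$ with measure coefficients on $\mathbb R^n\setminus\{0\}$ is strongly homogeneous if it is closed ($d\Omega=0$) and $\delta^\#\Omega=0$, where $\delta^\#$ is contraction with $\sum_jx_j\,\partial/\partial\xi_j$. For a $(1,0)$-form $a=\sum a_jdx_j$ put $a^\#=\sum a_jd\xi_j$. An elementary $(q,q)$-form is a constant-coefficient form $a_1\wedge a_1^\#\wedge\dots\wedge a_q\wedge a_q^\#$. A symmetric $(q,q)$-form at a point is weakly null if its wedge product with every elementary $(n-q,n-q)$-form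 is zero. A $(p,p)$-form is strong if at each point it is a finite real linear combination of elementary forms. A $(p,p)$-current $\Omega$ is strong if it is symmetric and $\int\Omega\wedge\Omega'=0$ for every smooth compactly supported symmetric $(n-p,n-p)$-form $\Omega'$ that is weakly null at each point (for continuous forms this agrees with the pointwise definition). *)

(* Defs.v *)
From mathcomp Require Import all_boot all_order all_algebra.
From mathcomp Require Import all_classical all_reals all_analysis.

Set Implicit Arguments.
Unset Strict Implicit.
Unset Printing Implicit Defensive.

Import Order.TTheory GRing.Theory Num.Theory.
Import numFieldNormedType.Exports.

Local Open Scope ring_scope.

(* The real exterior algebra on dx_1, .., dx_n, dxi_1, .., dxi_n: w (I, K) is
   the coefficient of w on dx_I /\ dxi_K, indices in increasing order. *)
Notation extalg R n := {ffun {set 'I_n} * {set 'I_n} -> R^o}.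

Section Exterior.
Variables (R : realType) (n : nat).

Definition mono (I K : {set 'I_n}) : extalg R n :=
  [ffun J : {set 'I_n} * {set 'I_n} => (J == (I, K))%:R].

Definition bideg (p q : nat) (w : extalg R n) : Prop :=
  forall I K : {set 'I_n}, ~~ ((#|I| == p) && (#|K| == q)) -> w (I, K) = 0.

Definition ninv (I J : {set 'I_n}) : nat :=
  #|[set ij : 'I_n * 'I_n | [&& ij.1 \in I, ij.2 \in J & (ij.2 < ij.1)%N]]|.

(* For I, I' disjoint and K, K' disjoint,
     dx_I /\ dxi_K /\ dx_I' /\ dxi_K'
       = wedge_sign I K I' K' * dx_(I u I') /\ dxi_(K u K'):
   move dx_I' across dxi_K, then sort the dx's and the dxi's. *)
Definition wedge_sign (I K I' K' : {set 'I_n}) : R :=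
  (-1) ^+ (#|K| * #|I'| + ninv I I' + ninv K K').

Definition wedge (u v : extalg R n) : extalg R n :=
  [ffun J : {set 'I_n} * {set 'I_n} => \sum_(I : {set 'I_n} | I \subset J.1)
             \sum_(K : {set 'I_n} | K \subset J.2)
     wedge_sign I K (J.1 :\: I) (J.2 :\: K) *
     u (I, K) * v (J.1 :\: I, J.2 :\: K)].

Definition ext1 : extalg R n := mono finset.set0 finset.set0.

Definition dx (j : 'I_n) : extalg R n := mono [set j] finset.set0.
Definition dxi (j : 'I_n) : extalg R n := mono finset.set0 [set j].

(* Coefficient of w on the volume form dx_1 /\ dxi_1 /\ .. /\ dx_n /\ dxi_n,
   which is (-1)^(n(n-1)/2) dx_1 /\ .. /\ dx_n /\ dxi_1 /\ .. /\ dxi_n. *)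
Definition volcoef (w : extalg R n) : R :=
  (-1) ^+ 'C(n, 2) * w ([set: 'I_n], [set: 'I_n]).

(* + or - dx_(~I) /\ dxi_(~K), with the sign for which
   dx_I /\ dxi_K /\ hodge_mono I K is the volume form. *)
Definition hodge_mono (I K : {set 'I_n}) : extalg R n :=
  volcoef (wedge (mono I K) (mono (~: I) (~: K))) *: mono (~: I) (~: K).

(* Interior product with the vector field d/dxi_j. *)
Definition contr_dxi (j : 'I_n) (w : extalg R n) : extalg R n :=
  [ffun J : {set 'I_n} * {set 'I_n} => if j \in J.2 then 0
             else (-1) ^+ (#|J.1| + ninv [set j] J.2) * w (J.1, j |: J.2)].

Definition oneform (a : 'rV[R]_n) : extalg R n := \sum_j a 0 j *: dx j.
Definition oneform_sharp (a : 'rV[R]_n) : extalg R n := \sum_j a 0 j *: dxi j.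

Definition elementary (q : nat) (a : 'I_q -> 'rV[R]_n) : extalg R n :=
  \big[wedge/ext1]_(i < q) wedge (oneform (a i)) (oneform_sharp (a i)).

Definition symmetric_ext (w : extalg R n) : Prop :=
  forall I K : {set 'I_n}, w (I, K) = w (K, I).

Definition weakly_null (q : nat) (w : extalg R n) : Prop :=
  [/\ bideg q q w, symmetric_ext w &
      forall a : 'I_(n - q) -> 'rV[R]_n, wedge w (elementary a) = 0].

End Exterior.

Local Open Scope classical_set_scope.

Section Superforms.
Variables (R : realType) (n : nat).
Local Notation space := 'rV[R]_n.

Definition superform : Type := space -> extalg R n.

Definition coef (al : superform) (I K : {set 'I_n}) : space -> R :=
  fun x => al x (I, K).

Definition partial (j : 'I_n) (f : space -> R) : space -> R :=
  fun x => 'D_(delta_mx 0 j : space) f x.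

Definition partials (s : seq 'I_n) (f : space -> R) : space -> R :=
  foldr partial f s.

Definition smooth (f : space -> R) : Prop :=
  forall s : seq 'I_n, continuous (partials s f) /\
    forall (j : 'I_n) (x : space),
      derivable (partials s f) x (delta_mx 0 j : space).

(* Smooth functions with compact support in U, extended by 0 outside U. *)
Definition test_fun (U : set space) (f : space -> R) : Prop :=
  let supp := closure [set x | f x != 0] in
  [/\ smooth f, compact supp & supp `<=` U].

Definition test_form (U : set space) (p q : nat) (al : superform) : Prop :=
  (forall x, bideg p q (al x)) /\ forall I K, test_fun U (coef al I K).

Definition superd (al : superform) : superform :=
  fun x => \sum_j wedge (dx R j)
    [ffun J : {set 'I_n} * {set 'I_n} => partial j (coef al J.1 J.2) x].

(* Contraction with sum_j x_j d/dxi_j. *)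
Definition delta_sharp (al : superform) : superform :=
  fun x => \sum_j x 0 j *: contr_dxi j (al x).

(* Pullback by F_t (x, xi) = (t x, xi), so dx_j |-> t dx_j, dxi_j |-> dxi_j. *)
Definition scale_pullback (t : R) (al : superform) : superform :=
  fun x => [ffun J : {set 'I_n} * {set 'I_n} => t ^+ #|J.1| * al (t *: x) J].

End Superforms.

Section Currents.
Variables (R : realType) (n : nat).
Local Notation space := 'rV[R]_n.

(* A current Om on U is given by its action al |-> int Om /\ al.  Only the
   values on test forms in U of complementary bidegree are meaningful. *)
Definition functional : Type := superform R n -> R.

Definition linear_on (D : set (superform R n)) (Om : functional) : Prop :=
  forall (c : R) (al be : superform R n), D al -> D be ->
    Om (fun x => c *: al x + be x) = c * Om al + Om be.

(* Continuity for the LF topology, in seminorm form. *)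
Definition continuous_on_tests (U : set space) (p q : nat)
    (Om : functional) : Prop :=
  forall C : set space, compact C -> C `<=` U ->
  exists (c : R) (N : nat), forall al : superform R n,
    test_form U p q al -> (forall x, ~ C x -> al x = 0) ->
    forall M : R,
      (forall I K (s : seq 'I_n) (x : space), (size s <= N)%N ->
         `|partials s (coef al I K) x| <= M) ->
      `|Om al| <= c * M.

Definition current (U : set space) (p q : nat) (Om : functional) : Prop :=
  linear_on (test_form U (n - p) (n - q)) Om /\
  continuous_on_tests U (n - p) (n - q) Om.

Definition current_eq (U : set space) (p q : nat) (Om Om' : functional) : Prop :=
  forall al, test_form U (n - p) (n - q) al -> Om al = Om' al.

(* The distribution Om_IK in Om = sum Om_IK dx_I /\ dxi_K. *)
Definition current_coef (Om : functional) (I K : {set 'I_n})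
    (f : space -> R) : R :=
  Om (fun x => f x *: hodge_mono R I K).

Definition borel_space := g_sigma_algebraType (@open space).

Definition locally_finite_on (U : set space)
    (mu : {measure set borel_space -> \bar R}) : Prop :=
  forall C : set space, compact C -> C `<=` U -> (mu C < +oo)%E.

(* A real Radon measure on U need not have finite total variation, hence the
   difference of two locally finite positive measures. *)
Definition measure_coefs (U : set space) (p q : nat) (Om : functional) : Prop :=
  forall I K : {set 'I_n}, #|I| = p -> #|K| = q ->
  exists mu nu : {measure set borel_space -> \bar R},
    [/\ locally_finite_on U mu, locally_finite_on U nu &
      forall f, test_fun U f ->
        current_coef Om I K f =
          \int[mu]_(x in U) f x - \int[nu]_(x in U) f x].

(* d and delta^# act on currents of bidegree (p, q) by duality, both being
   antiderivations: int d(Om /\ al) = 0 for al of bidegree (n-p-1, n-q), and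
   delta^#(Om /\ al) = 0 for al of bidegree (n-p, n-q+1) since then already
   Om /\ al = 0. *)
Definition current_d (p q : nat) (Om : functional) : functional :=
  fun al => (-1) ^+ (p + q).+1 * Om (superd al).

Definition current_delta_sharp (p q : nat) (Om : functional) : functional :=
  fun al => (-1) ^+ (p + q).+1 * Om (delta_sharp al).

(* By duality from int F_t^*(be) = int be on forms be of bidegree (n, n). *)
Definition current_scale (t : R) (Om : functional) : functional :=
  fun al => Om (scale_pullback t^-1 al).

(* For p = n, d Om has bidegree (n+1, q) and vanishes, hence p < n. *)
Definition current_closed (U : set space) (p q : nat) (Om : functional) : Prop :=
  (p < n)%N -> forall al, test_form U (n - p.+1) (n - q) al ->
    current_d p q Om al = 0.

(* delta^# Om has bidegree (p, q-1), so the test forms have bidegree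
   (n-p, n-q+1); for q = 0 these are all zero. *)
Definition current_delta_sharp_closed (U : set space) (p q : nat)
    (Om : functional) : Prop :=
  forall al, test_form U (n - p) (n - q).+1 al ->
    current_delta_sharp p q Om al = 0.

Definition punctured : set space := ~` [set 0].

Definition strongly_homogeneous (p : nat) (Om : functional) : Prop :=
  [/\ current punctured p p Om, measure_coefs punctured p p Om,
      current_closed punctured p p Om &
      current_delta_sharp_closed punctured p p Om].

Definition symmetric_current (U : set space) (p : nat) (Om : functional) : Prop :=
  forall I K : {set 'I_n}, #|I| = p -> #|K| = p ->
  forall f, test_fun U f -> current_coef Om I K f = current_coef Om K I f.

Definition strong_current (U : set space) (p : nat) (Om : functional) : Prop :=
  symmetric_current U p Om /\
  forall al, test_form U (n - p) (n - p) al ->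
    (forall x, weakly_null (n - p) (al x)) -> Om al = 0.

Definition homogeneous_order_zero (U : set space) (p : nat)
    (Om : functional) : Prop :=
  forall t : R, 0 < t -> current_eq U p p (current_scale t Om) Om.

End Currents.

(* Main.v *)
(* Let [J = d delta# + delta# d]; pointwise [J] is the algebraic operator
   [w |-> sum_j dx_j /\ (contraction of w with d/dxi_j)], and a strongly
   homogeneous current of bidegree (p, p) vanishes on the image of [J].
   The span E of the elementary forms is killed by [J], and in every bidegree
   (q, q) one has E + im J = everything: this is proved by induction on q,
   moving a [dxi_i] through [J].  Using it in bidegrees (q, q) and (p, p),
   p + q = n, a form whose products with the elementary (p, p)-forms all vanish
   lies in im J.  Weakly null forms and antisymmetric forms are of this kind,
   so the current is strong, in particular symmetric.  By symmetry the current
   is also killed by the contraction [delta] with the Euler field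
   [sum_j x_j d/dx_j], hence by its Lie derivative [d delta + delta d], which
   is the derivative of the pullbacks under dilation. *)
Require Import Defs.
From mathcomp Require Import all_boot all_order all_algebra.
From mathcomp Require Import all_classical all_reals all_analysis.
From mathcomp Require Import zify ring.

Set Implicit Arguments.
Unset Strict Implicit.
Unset Printing Implicit Defensive.

Import Order.TTheory GRing.Theory Num.Theory.
Import numFieldNormedType.Exports.
Local Open Scope ring_scope.

(** * The exterior algebra *)

(** The sum E + im J is used in two complementary bidegrees for different reasons: in (q, q) it
    reduces a form to a strong remainder e, in (p, p) it supplies enough test vectors to conclude e
    = 0. Images of J do not interfere there: for strong e of bidegree (p, p) and b of bidegree (q-1,
    q+1), e /\ J b = J (e /\ b), and e /\ b has n + 1 factors dxi. A primitive under J of a test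
    form must itself be a test form. It is therefore chosen once per monomial and extended linearly
    with constant coefficients, so that smoothness and compact support are inherited. For the
    scaling, a current cannot a priori be differentiated along a path of forms. With t = e^s the
    dilations become a one-parameter group. Subtracting the first-order term, on which the current
    vanishes, leaves a remainder of order s^2 in every seminorm, and continuity on one compact set
    turns this into a zero derivative. *)

Section WedgeProduct.
Variables (R : realType) (n : nat).
Local Notation ext := (extalg R n).
Implicit Types (u v w : ext) (a : 'rV[R]_n) (i j k : 'I_n) (I J K : {set 'I_n}).

(** As a double sum the inversion number is additive in each argument over disjoint unions, which is
    what the sign computations rest on. *)
Lemma ninvE I J : ninv I J = (\sum_(i in I) \sum_(j in J) (j < i)%N)%N.
Proof.
rewrite /ninv -sum1_card pair_big_dep /=.
rewrite [RHS](eq_bigr (fun p : 'I_n * 'I_n => if (p.2 < p.1)%N then 1%N else 0%N)); last first.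
  by move=> p _; case: ltnP.
rewrite -big_mkcondr /=; apply: eq_bigl => -[i j] /=; rewrite !inE /=.
by rewrite andbA.
Qed.

Lemma ninvUl I I' J : [disjoint I & I'] ->
  ninv (I :|: I') J = (ninv I J + ninv I' J)%N.
Proof.
move=> dI; rewrite !ninvE -bigU //=.
by apply: eq_bigl => i; rewrite !inE.
Qed.

Lemma ninvUr I J J' : [disjoint J & J'] ->
  ninv I (J :|: J') = (ninv I J + ninv I J')%N.
Proof.
move=> dJ; rewrite !ninvE -big_split; apply: eq_bigr => i _ /=.
by rewrite -bigU //=; apply: eq_bigl => j; rewrite !inE.
Qed.

Lemma ninv0l J : ninv finset.set0 J = 0%N.
Proof. by rewrite ninvE big_set0. Qed.

Lemma ninv0r I : ninv I finset.set0 = 0%N.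
Proof. by rewrite ninvE big1 // => i _; rewrite big_set0. Qed.

Lemma ninv11 i j : ninv [set i] [set j] = (j < i)%N :> nat.
Proof. by rewrite ninvE !big_set1. Qed.

(** For i != j exactly one of (i, j), (j, i) is an inversion; disjointness excludes the diagonal. *)
Lemma ninvC I J : [disjoint I & J] -> (ninv I J + ninv J I = #|I| * #|J|)%N.
Proof.
move=> dIJ; rewrite !ninvE [X in (_ + X)%N]exchange_big /= -big_split /=.
rewrite -sum1_card big_distrl /=; apply: eq_bigr => i iI.
rewrite mul1n -sum1_card -big_split /=; apply: eq_bigr => j jJ.
case: ltngtP => // /val_inj ij; subst j.
by move/disjoint_setI0/setP/(_ i): dIJ; rewrite !inE iI jJ.
Qed.

Lemma extP u v : (forall I K, u (I, K) = v (I, K) :> R) -> u = v.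
Proof. by move=> uv; apply/ffunP => -[I K]; exact: uv. Qed.

Lemma extD u v I K : (u + v) (I, K) = u (I, K) + v (I, K) :> R.
Proof. by rewrite ffunE. Qed.

Lemma extN u I K : (- u) (I, K) = - u (I, K) :> R.
Proof. by rewrite ffunE. Qed.

Lemma extZ (c : R) u I K : (c *: u) (I, K) = c * u (I, K) :> R.
Proof. by rewrite ffunE. Qed.

Lemma ext0 I K : (0 : ext) (I, K) = 0 :> R.
Proof. by rewrite ffunE. Qed.

Lemma monoE I K I' K' : mono R I K (I', K') = ((I' == I) && (K' == K))%:R :> R.
Proof. by rewrite ffunE -pair_eqE. Qed.

Lemma ext_sum_mono u : u = \sum_I \sum_K (u (I, K) : R) *: mono R I K.
Proof.
apply: extP => I K; rewrite sum_ffunE (bigD1 I) //= sum_ffunE (bigD1 K) //=.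
rewrite extZ monoE !eqxx mulr1 !big1 ?addr0 // => J; rewrite eq_sym => /negPf JI.
  by rewrite sum_ffunE big1 // => L _; rewrite extZ monoE JI mulr0.
by rewrite extZ monoE JI andbF mulr0.
Qed.

Lemma wedgeDl u v w : wedge (u + v) w = wedge u w + wedge v w.
Proof.
apply: extP => I K; rewrite !ffunE -big_split /=; apply: eq_bigr => A _.
rewrite -big_split; apply: eq_bigr => B _ /=.
by rewrite extD mulrDr mulrDl.
Qed.

Lemma wedgeDr u v w : wedge w (u + v) = wedge w u + wedge w v.
Proof.
apply: extP => I K; rewrite !ffunE -big_split /=; apply: eq_bigr => A _.
rewrite -big_split; apply: eq_bigr => B _ /=.
by rewrite extD mulrDr.
Qed.

Lemma wedgeZl (c : R) u w : wedge (c *: u) w = c *: wedge u w.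
Proof.
apply: extP => I K; rewrite extZ !ffunE big_distrr /=; apply: eq_bigr => A _.
rewrite big_distrr; apply: eq_bigr => B _ /=.
by rewrite extZ; ring.
Qed.

Lemma wedgeZr (c : R) u w : wedge w (c *: u) = c *: wedge w u.
Proof.
apply: extP => I K; rewrite extZ !ffunE big_distrr /=; apply: eq_bigr => A _.
rewrite big_distrr; apply: eq_bigr => B _ /=.
by rewrite extZ; ring.
Qed.

Lemma wedge0l w : wedge 0 w = 0.
Proof. by rewrite -(scale0r 0) wedgeZl !scale0r. Qed.

Lemma wedge0r w : wedge w 0 = 0.
Proof. by rewrite -(scale0r 0) wedgeZr !scale0r. Qed.

Lemma wedgeNl u w : wedge (- u) w = - wedge u w.
Proof. by rewrite -[in LHS]scaleN1r wedgeZl scaleN1r. Qed.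

Lemma wedgeNr u w : wedge w (- u) = - wedge w u.
Proof. by rewrite -[in LHS]scaleN1r wedgeZr scaleN1r. Qed.

Lemma wedge_suml (T : Type) (r : seq T) (P : pred T) (F : T -> ext) w :
  wedge (\sum_(i <- r | P i) F i) w = \sum_(i <- r | P i) wedge (F i) w.
Proof.
by elim/big_rec2: _ => [|i y1 y2 _ <-]; rewrite ?wedge0l ?wedgeDl.
Qed.

Lemma wedge_sumr (T : Type) (r : seq T) (P : pred T) (F : T -> ext) w :
  wedge w (\sum_(i <- r | P i) F i) = \sum_(i <- r | P i) wedge w (F i).
Proof.
by elim/big_rec2: _ => [|i y1 y2 _ <-]; rewrite ?wedge0r ?wedgeDr.
Qed.

Definition wedgeE := (wedgeDl, wedgeDr, wedgeZl, wedgeZr, wedgeNl, wedgeNr,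
  wedge0l, wedge0r).

(** Translates between the splittings summed over in [wedge] (a subset and its complement) and the
    disjoint unions natural for products of monomials. *)
Lemma setU_disjointE (A B C : {set 'I_n}) :
  (B \subset A) && (A :\: B == C) = [disjoint B & C] && (A == B :|: C).
Proof.
rewrite -finset.setI_eq0; apply/andP/andP => [[BA /eqP <-]|[/eqP BC /eqP ->]]; split.
- by apply/eqP/finset.setP => x; rewrite !inE; case: (x \in B).
- by rewrite -{1}(finset.setID A B) (finset.setIidPr BA).
- exact: finset.subsetUl.
apply/eqP/finset.setP => x; move/finset.setP/(_ x): BC; rewrite !inE.
by case: (x \in B) => //= ->.
Qed.

Lemma wedge_mono I K I' K' : wedge (mono R I K) (mono R I' K') =
  if [disjoint I & I'] && [disjoint K & K']
  then wedge_sign R I K I' K' *: mono R (I :|: I') (K :|: K') else 0.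
Proof.
apply: extP => A B; transitivity (\sum_(I0 : {set 'I_n} | I0 == I)
    \sum_(K0 : {set 'I_n} | K0 == K)
    (((I \subset A) && (A :\: I == I')) && ((K \subset B) && (B :\: K == K')))%:R
    * wedge_sign R I K I' K').
  rewrite ffunE big_mkcond [RHS]big_mkcond; apply: eq_bigr => I0 _ /=.
  case: eqP => [->|/eqP/negPf I0I]; last first.
    by case: ifP => // _; rewrite big1 // => K0 _; rewrite monoE I0I mulr0 mul0r.
  case: ifP => IA; last by rewrite big1 // => K0 _; rewrite mul0r.
  rewrite big_mkcond [RHS]big_mkcond; apply: eq_bigr => K0 _ /=.
  case: eqP => [->|/eqP/negPf K0K]; last first.
    by case: ifP => // _; rewrite monoE K0K andbF mulr0 mul0r.
  case: ifP => KB; last by rewrite andbF mul0r.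
  rewrite !monoE !eqxx /= mulr1.
  by do 2 case: eqP => [->|_]; rewrite ?mulr1 ?mul1r ?mulr0 ?mul0r.
rewrite !big_pred1_eq !setU_disjointE.
case: ifP; case: [disjoint I & I']; case: [disjoint K & K'] => //= _;
  rewrite ?andbF ?extZ ?ext0 ?monoE ?mul0r //; exact: mulrC.
Qed.

Lemma wedge_monoA I K I' K' I2 K2 :
  wedge (mono R I K) (wedge (mono R I' K') (mono R I2 K2)) =
  wedge (wedge (mono R I K) (mono R I' K')) (mono R I2 K2).
Proof.
have dU (A B C : {set 'I_n}) : [disjoint A & B :|: C] = [disjoint A & B] && [disjoint A & C].
  by rewrite -!finset.setI_eq0 finset.setIUr finset.setU_eq0.
have dU' (A B C : {set 'I_n}) : [disjoint B :|: C & A] = [disjoint B & A] && [disjoint C & A].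
  by rewrite -!finset.setI_eq0 finset.setIUl finset.setU_eq0.
rewrite !wedge_mono.
case dI: [disjoint I & I']; case dK: [disjoint K & K'];
case dI1: [disjoint I' & I2]; case dK1: [disjoint K' & K2];
case dI2: [disjoint I & I2]; case dK2: [disjoint K & K2];
  rewrite /= ?wedgeE ?wedge_mono ?dU ?dU' ?dI ?dK ?dI1 ?dK1 ?dI2 ?dK2 /= ?scaler0 //.
rewrite !scalerA !finset.setUA; congr (_ *: _).
(* The exponents agree as natural numbers, not merely modulo 2, by additivity of [ninv] and of
   cardinalities. *)
rewrite /wedge_sign -!exprD; congr (_ ^+ _).
rewrite ninvUl // ninvUl // ninvUr // ninvUr // !cardsU !disjoint_setI0 // !cards0 !subn0.
ring.
Qed.

Lemma wedgeA u v w : wedge u (wedge v w) = wedge (wedge u v) w.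
Proof.
rewrite (ext_sum_mono u) !wedge_suml; apply: eq_bigr => I _.
rewrite !wedge_suml; apply: eq_bigr => K _; rewrite !wedgeZl; congr (_ *: _).
rewrite (ext_sum_mono v) wedge_sumr !wedge_suml wedge_sumr.
apply: eq_bigr => I1 _.
rewrite wedge_sumr !wedge_suml wedge_sumr.
apply: eq_bigr => K1 _; rewrite !(wedgeZl, wedgeZr); congr (_ *: _).
rewrite (ext_sum_mono w) !wedge_sumr; apply: eq_bigr => I2 _.
rewrite !wedge_sumr; apply: eq_bigr => K2 _; rewrite !wedgeZr; congr (_ *: _).
exact: wedge_monoA.
Qed.

Lemma wedge1l w : wedge (ext1 R n) w = w.
Proof.
rewrite {1}(ext_sum_mono w) wedge_sumr {2}(ext_sum_mono w); apply: eq_bigr => I _.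
rewrite wedge_sumr; apply: eq_bigr => K _; rewrite wedgeZr wedge_mono.
by rewrite -!finset.setI_eq0 !finset.set0I eqxx /= !finset.set0U /wedge_sign cards0
  !ninv0l mul0n expr0 scale1r.
Qed.

Lemma wedge1r w : wedge w (ext1 R n) = w.
Proof.
rewrite {1}(ext_sum_mono w) wedge_suml {2}(ext_sum_mono w); apply: eq_bigr => I _.
rewrite wedge_suml; apply: eq_bigr => K _; rewrite wedgeZl wedge_mono.
by rewrite -!finset.setI_eq0 !finset.setI0 eqxx /= !finset.setU0 /wedge_sign cards0
  !ninv0r muln0 expr0 scale1r.
Qed.

(** The sign of sorting an index [j] placed in front into the increasing product over [I]; it serves
    the dx's and the dxi's alike. *)
Definition sg j I : R := (-1) ^+ ninv [set j] I.

Lemma sgK j I : sg j I * sg j I = 1.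
Proof. by rewrite -expr2 sqrr_sign. Qed.

Lemma sgU1 i j I : j \notin I -> sg i (j |: I) = (-1) ^+ (j < i)%N * sg i I.
Proof.
by move=> jI; rewrite /sg ninvUr ?disjoints1 // ninv11 exprD.
Qed.

(** Each coefficient of the product is at most one coefficient of [w] up to sign, which makes this
    operator compatible with differentiation of coefficients. *)
Lemma wedge_dxE j w I K : wedge (dx R j) w (I, K) =
  (if j \in I then sg j (I :\ j) * w (I :\ j, K) else 0) :> R.
Proof.
rewrite {1}(ext_sum_mono w) wedge_sumr sum_ffunE.
rewrite (eq_bigr (fun A : {set 'I_n} => if (j \in I) && (A == I :\ j) then
   sg j (I :\ j) * w (I :\ j, K) else 0)) => [|A _].
  by case: (j \in I) => /=; [rewrite -big_mkcond big_pred1_eq | rewrite big1].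
rewrite wedge_sumr sum_ffunE (bigD1 K) //= big1 ?addr0 => [|B]; last first.
  rewrite eq_sym => /negPf BK.
  rewrite wedgeZr wedge_mono extZ; case: ifP; rewrite ?ext0 ?mulr0 // => _.
  by rewrite extZ monoE finset.set0U BK andbF !mulr0.
rewrite wedgeZr wedge_mono extZ disjoints1 -finset.setI_eq0 finset.set0I eqxx andbT.
have -> : (j \in I) && (A == I :\ j) = (j \notin A) && (I == j |: A).
  rewrite -disjoints1 -setU_disjointE finset.sub1set; congr (_ && _); exact: eq_sym.
case: ifP => /= jA; last by rewrite ext0 mulr0.
rewrite extZ monoE finset.set0U eqxx andbT; case: eqP => /= [->|_]; last by rewrite !mulr0.
rewrite mulr1 mulrC finset.setU1K // /wedge_sign cards0 ninv0l mul0n addn0.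
by [].
Qed.

End WedgeProduct.

(** * Contractions, their anticommutation relations and the operator [ext_J] *)

Section Contractions.
Variables (R : realType) (n : nat).
Local Notation ext := (extalg R n).
Implicit Types (u v w : ext) (a : 'rV[R]_n) (i j k : 'I_n) (I J K : {set 'I_n}).

Lemma wedge_dxiE j w I K : wedge (dxi R j) w (I, K) =
  (if j \in K then (-1) ^+ #|I| * sg R j (K :\ j) * w (I, K :\ j) else 0) :> R.
Proof.
rewrite {1}(ext_sum_mono w) wedge_sumr sum_ffunE (bigD1 I) //= [X in _ + X]big1 ?addr0; last first.
  move=> A; rewrite eq_sym => /negPf AI; rewrite wedge_sumr sum_ffunE big1 // => B _.
  rewrite wedgeZr wedge_mono extZ; case: ifP; rewrite ?ext0 ?mulr0 // => _.
  by rewrite extZ monoE finset.set0U AI !mulr0.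
rewrite wedge_sumr sum_ffunE.
rewrite (eq_bigr (fun B : {set 'I_n} => if (j \in K) && (B == K :\ j) then
   (-1) ^+ #|I| * sg R j (K :\ j) * w (I, K :\ j) else 0)) => [|B _].
  by case: (j \in K) => /=; [rewrite -big_mkcond big_pred1_eq | rewrite big1].
rewrite wedgeZr wedge_mono extZ -finset.setI_eq0 finset.set0I eqxx disjoints1 /=.
have -> : (j \in K) && (B == K :\ j) = (j \notin B) && (K == j |: B).
  rewrite -disjoints1 -setU_disjointE finset.sub1set; congr (_ && _); exact: eq_sym.
case: ifP => /= jB; last by rewrite ext0 mulr0.
rewrite extZ monoE finset.set0U eqxx /=; case: eqP => /= [->|_]; last by rewrite !mulr0.
by rewrite mulr1 mulrC finset.setU1K // /wedge_sign cards1 ninv0l mul1n addn0 exprD.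
Qed.

Lemma contr_dxiE j w I K : contr_dxi j w (I, K) =
  (if j \in K then 0 else (-1) ^+ #|I| * sg R j K * w (I, j |: K)) :> R.
Proof. by rewrite ffunE /= exprD. Qed.

(** Interior product with d/dx_j. Unlike in [contr_dxi] there is no factor [(-1) ^+ #|J.1|], because
    the dx's stand first. *)
Definition contr_dx j w : ext :=
  [ffun J : {set 'I_n} * {set 'I_n} => if j \in J.1 then 0
             else sg R j J.1 * w (j |: J.1, J.2)].

Lemma contr_dxE j w I K : contr_dx j w (I, K) =
  (if j \in I then 0 else sg R j I * w (j |: I, K)) :> R.
Proof. by rewrite ffunE. Qed.

(** Exactly one of i < j and j < i holds, so exchanging the order of insertion changes the sign
    once. *)
Lemma sgC i j I : i != j -> i \notin I -> j \notin I ->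
  sg R i (j |: I) * sg R j (i |: I) = - (sg R j I * sg R i I).
Proof.
move=> ij iI jI; rewrite !sgU1 //.
case: (ltngtP i j) => [||/val_inj e]; last by rewrite e eqxx in ij.
  by move=> _; rewrite expr0 expr1; ring.
by move=> _; rewrite expr0 expr1; ring.
Qed.

Lemma setU1D1 i j I : i != j -> (i |: I) :\ j = i |: (I :\ j).
Proof.
move=> /negPf ij; apply/finset.setP => x; rewrite !inE.
by case: eqP => // ->; rewrite eq_sym ij.
Qed.

Lemma contr_dxi_wedge_dx k j w :
  contr_dxi k (wedge (dx R j) w) = - wedge (dx R j) (contr_dxi k w).
Proof.
apply: extP => I K; rewrite extN contr_dxiE !wedge_dxE contr_dxiE.
case: ifP => kK; first by case: ifP => _; rewrite ?mulr0 oppr0.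
case: ifP => jI; last by rewrite mulr0 oppr0.
rewrite (cardsD1 j I) jI exprD expr1; ring.
Qed.

(** The Clifford relation: for j = k the two terms cancel on monomials containing dxi_k, and only
    the first survives on the others. *)
Lemma contr_dxi_wedge_dxi k j w : contr_dxi k (wedge (dxi R j) w) =
  (j == k)%:R *: w - wedge (dxi R j) (contr_dxi k w).
Proof.
apply: extP => I K; rewrite extD extN extZ contr_dxiE !wedge_dxiE contr_dxiE !inE.
have sI (x : R) : (-1) ^+ #|I| * ((-1) ^+ #|I| * x) = x.
  by rewrite !(mul1r, mulrA) -expr2 sqrr_sign mul1r.
case: (eqVneq j k) => [->|jk] /=.
  rewrite ?eqxx /= mul1r; case: ifP => kK.
    by rewrite finset.setD1K // -!mulrA (mulrCA (sg _ _ _)) sI mulrA sgK mul1r subrr.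
  by rewrite subr0 finset.setU1K ?kK // -!mulrA (mulrCA (sg _ _ _)) sI mulrA sgK mul1r.
rewrite 1?eq_sym ?(negPf jk) mul0r add0r /=.
case: ifP => kK; first by rewrite mulr0; case: ifP => _; rewrite ?mulr0 oppr0.
case: ifP => jK; last by rewrite mulr0 oppr0.
rewrite setU1D1 1?eq_sym // -!mulrA (mulrCA (sg _ k K)) sI
  (mulrCA (sg _ j (K :\ j))) sI.
have {1}-> : K = j |: (K :\ j) by rewrite finset.setD1K.
rewrite !mulrA sgC 1?eq_sym ?inE ?eqxx ?kK ?andbF //; ring.
Qed.

Lemma contr_dx_wedge_dx k j w : contr_dx k (wedge (dx R j) w) =
  (j == k)%:R *: w - wedge (dx R j) (contr_dx k w).
Proof.
apply: extP => I K; rewrite extD extN extZ contr_dxE !wedge_dxE contr_dxE !inE.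
case: (eqVneq j k) => [->|jk] /=.
  rewrite ?eqxx /= mul1r; case: ifP => kI.
    by rewrite finset.setD1K // !mulrA sgK mul1r subrr.
  by rewrite subr0 finset.setU1K ?kI // !mulrA sgK mul1r.
rewrite 1?eq_sym ?(negPf jk) mul0r add0r /=.
case: ifP => kI; first by rewrite mulr0; case: ifP => _; rewrite ?mulr0 oppr0.
case: ifP => jI; last by rewrite mulr0 oppr0.
rewrite setU1D1 1?eq_sym //.
have {1}-> : I = j |: (I :\ j) by rewrite finset.setD1K.
rewrite !mulrA sgC 1?eq_sym ?inE ?eqxx ?kI ?andbF //; ring.
Qed.

(** Every index of [I] contributes the coefficient once: the sum is the number operator counting dx
    factors. *)
Lemma sum_wedge_dx_contr w I K :
  (\sum_j wedge (dx R j) (contr_dx j w)) (I, K) = #|I|%:R * w (I, K) :> R.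
Proof.
rewrite sum_ffunE (eq_bigr (fun j => (j \in I)%:R * w (I, K))) => [|j _].
  rewrite -mulr_suml -natr_sum -sum1_card [in RHS]big_mkcond.
  by congr (_%:R * _); apply: eq_bigr => j _; case: ifP.
rewrite wedge_dxE contr_dxE !inE; case: ifP => jI; last by rewrite mul0r.
by rewrite eqxx finset.setD1K // mulrA sgK.
Qed.

Lemma sum_wedge_dxi_contr w I K :
  (\sum_j wedge (dxi R j) (contr_dxi j w)) (I, K) = #|K|%:R * w (I, K) :> R.
Proof.
rewrite sum_ffunE (eq_bigr (fun j => (j \in K)%:R * w (I, K))) => [|j _].
  rewrite -mulr_suml -natr_sum -sum1_card [in RHS]big_mkcond.
  by congr (_%:R * _); apply: eq_bigr => j _; case: ifP.
rewrite wedge_dxiE contr_dxiE !inE; case: ifP => jK; last by rewrite mul0r.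
rewrite eqxx finset.setD1K // -!mulrA (mulrCA (sg _ j _)) (mulrA (sg _ j _)) sgK.
by rewrite !(mul1r, mulrA) -expr2 sqrr_sign mul1r.
Qed.

(** The even derivation of the exterior algebra with dxi_j |-> dx_j and dx_j |-> 0. *)
Definition ext_J w : ext := \sum_j wedge (dx R j) (contr_dxi j w).

Lemma contr_dxiD j u v : contr_dxi j (u + v) = contr_dxi j u + contr_dxi j v.
Proof.
apply: extP => I K; rewrite extD !contr_dxiE extD.
by case: ifP => _; rewrite ?addr0 // mulrDr.
Qed.

Lemma contr_dxiZ j (c : R) u : contr_dxi j (c *: u) = c *: contr_dxi j u.
Proof.
apply: extP => I K; rewrite extZ !contr_dxiE extZ.
by case: ifP => _; rewrite ?mulr0 // mulrCA.
Qed.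

Lemma contr_dxi0 j : contr_dxi j (0 : ext) = 0.
Proof. by rewrite -(scale0r 0) contr_dxiZ !scale0r. Qed.

Lemma contr_dxi_sum (T : Type) (r : seq T) (P : pred T) (F : T -> ext) j :
  contr_dxi j (\sum_(i <- r | P i) F i) = \sum_(i <- r | P i) contr_dxi j (F i).
Proof.
by elim/big_rec2: _ => [|i y1 y2 _ <-]; rewrite ?contr_dxi0 ?contr_dxiD.
Qed.

Lemma contr_dxD j u v : contr_dx j (u + v) = contr_dx j u + contr_dx j v.
Proof.
apply: extP => I K; rewrite extD !contr_dxE extD.
by case: ifP => _; rewrite ?addr0 // mulrDr.
Qed.

Lemma contr_dxZ j (c : R) u : contr_dx j (c *: u) = c *: contr_dx j u.
Proof.
apply: extP => I K; rewrite extZ !contr_dxE extZ.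
by case: ifP => _; rewrite ?mulr0 // mulrCA.
Qed.

Lemma contr_dx0 j : contr_dx j (0 : ext) = 0.
Proof. by rewrite -(scale0r 0) contr_dxZ !scale0r. Qed.

Lemma contr_dx_sum (T : Type) (r : seq T) (P : pred T) (F : T -> ext) j :
  contr_dx j (\sum_(i <- r | P i) F i) = \sum_(i <- r | P i) contr_dx j (F i).
Proof.
by elim/big_rec2: _ => [|i y1 y2 _ <-]; rewrite ?contr_dx0 ?contr_dxD.
Qed.

Lemma ext_JD u v : ext_J (u + v) = ext_J u + ext_J v.
Proof.
rewrite -big_split; apply: eq_bigr => j _ /=.
by rewrite contr_dxiD wedgeDr.
Qed.

Lemma ext_JZ (c : R) u : ext_J (c *: u) = c *: ext_J u.
Proof.
rewrite scaler_sumr; apply: eq_bigr => j _.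
by rewrite contr_dxiZ wedgeZr.
Qed.

Lemma ext_J0 : ext_J 0 = 0.
Proof. by rewrite -(scale0r 0) ext_JZ !scale0r. Qed.

Lemma ext_J_sum (T : Type) (r : seq T) (P : pred T) (F : T -> ext) :
  ext_J (\sum_(i <- r | P i) F i) = \sum_(i <- r | P i) ext_J (F i).
Proof.
by elim/big_rec2: _ => [|i y1 y2 _ <-]; rewrite ?ext_J0 ?ext_JD.
Qed.

(** The grading involution, which gives the sign for moving a one-form past [w]. *)
Definition parity w : ext :=
  [ffun J : {set 'I_n} * {set 'I_n} => (-1) ^+ (#|J.1| + #|J.2|) * w J].

Lemma parityE w I K : parity w (I, K) = (-1) ^+ (#|I| + #|K|) * w (I, K) :> R.
Proof. by rewrite ffunE. Qed.

Lemma parityK w : parity (parity w) = w.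
Proof.
by apply: extP => I K; rewrite !parityE mulrA -expr2 sqrr_sign mul1r.
Qed.

Lemma sum_mono_ind (P : ext -> Prop) :
  P 0 -> (forall u v, P u -> P v -> P (u + v)) ->
  (forall (c : R) u, P u -> P (c *: u)) -> forall w,
  (forall I K, w (I, K) != 0 :> R -> P (mono R I K)) -> P w.
Proof.
move=> P0 PD PZ w Pw; rewrite (ext_sum_mono w).
elim/big_ind: _ => // I _; elim/big_ind: _ => // K _.
have [->|wIK] := eqVneq (w (I, K) : R) 0; first by rewrite scale0r.
exact: PZ (Pw _ _ wIK).
Qed.

Lemma wedge_parityC v :
  (forall I K, wedge v (mono R I K) = (-1 : R) ^+ (#|I| + #|K|) *: wedge (mono R I K) v) ->
  forall u, wedge v u = wedge (parity u) v.
Proof.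
move=> vC u; pose P u := wedge v u = wedge (parity u) v.
change (P u); apply: sum_mono_ind => [|u1 u2 H1 H2|c u1 H|I K _]; rewrite /P.
- have -> : parity 0 = 0 by apply: extP => I K; rewrite parityE ext0 mulr0.
  by rewrite wedge0l wedge0r.
- rewrite wedgeDr H1 H2 -wedgeDl; congr (wedge _ _).
  by apply: extP => I K; rewrite extD !parityE extD mulrDr.
- rewrite wedgeZr H -wedgeZl; congr (wedge _ _).
  by apply: extP => I K; rewrite extZ !parityE extZ mulrCA.
rewrite vC -wedgeZl; congr (wedge _ _); apply: extP => I' K'.
by rewrite parityE extZ monoE; do 2 case: eqP => [->|_]; rewrite ?mulr0.
Qed.

Lemma sign_eq_odd (a b : nat) : odd a = odd b -> (-1) ^+ a = (-1) ^+ b :> R.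
Proof. by move=> ab; rewrite -signr_odd ab signr_odd. Qed.

Lemma wedge_dxC j u : wedge (dx R j) u = wedge (parity u) (dx R j).
Proof.
apply: wedge_parityC => I K; rewrite !wedge_mono -!finset.setI_eq0.
rewrite finset.set0I finset.setI0 eqxx !andbT finset.setIC.
case: ifP => dI; last by rewrite scaler0.
rewrite scalerA -exprD finset.setU0 finset.set0U finset.setUC; congr (_ *: _).
apply: sign_eq_odd; rewrite finset.setI_eq0 in dI.
have := ninvC dI; rewrite cards1 muln1 => <-.
rewrite cards0 ninv0l ninv0r mul0n muln1 !addn0 add0n !oddD.
by do 3 case: odd.
Qed.

Lemma wedge_dxiC j u : wedge (dxi R j) u = wedge (parity u) (dxi R j).
Proof.
apply: wedge_parityC => I K; rewrite !wedge_mono -!finset.setI_eq0.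
rewrite finset.set0I finset.setI0 eqxx !andTb finset.setIC.
case: ifP => dI; last by rewrite scaler0.
rewrite scalerA -exprD finset.setU0 finset.set0U finset.setUC; congr (_ *: _).
apply: sign_eq_odd; rewrite finset.setI_eq0 in dI.
have := ninvC dI; rewrite cards1 muln1 => <-.
rewrite cards0 ninv0l ninv0r muln0 mul1n !addn0 add0n !oddD.
by do 3 case: odd.
Qed.

End Contractions.

(** * Bidegrees and elementary forms *)

Section ElementaryForms.
Variables (R : realType) (n : nat).
Local Notation ext := (extalg R n).
Implicit Types (u v w : ext) (a : 'rV[R]_n) (i j k : 'I_n) (I J K : {set 'I_n}).

Lemma bideg0 p q : bideg p q (0 : ext).
Proof. by move=> I K _; rewrite ext0. Qed.

Lemma bidegD p q u v : bideg p q u -> bideg p q v -> bideg p q (u + v).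
Proof. by move=> hu hv I K h; rewrite extD hu // hv // addr0. Qed.

Lemma bidegZ p q (c : R) u : bideg p q u -> bideg p q (c *: u).
Proof. by move=> hu I K h; rewrite extZ hu // mulr0. Qed.

Lemma bideg_sum p q (T : Type) (r : seq T) (P : pred T) (F : T -> ext) :
  (forall x, P x -> bideg p q (F x)) -> bideg p q (\sum_(i <- r | P i) F i).
Proof. by move=> h; elim/big_ind: _ => //; [exact: bideg0 | exact: bidegD]. Qed.

Lemma bideg_mono I K : bideg #|I| #|K| (mono R I K).
Proof.
move=> I' K'; rewrite monoE; have [->|] := eqVneq I' I => //.
by have [->|] := eqVneq K' K => //; rewrite !eqxx.
Qed.

Lemma bideg_dx j : bideg 1 0 (dx R j).
Proof. by have := @bideg_mono [set j] finset.set0; rewrite cards0 cards1. Qed.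

Lemma bideg_dxi j : bideg 0 1 (dxi R j).
Proof. by have := @bideg_mono finset.set0 [set j]; rewrite cards0 cards1. Qed.

Lemma bideg_wedge p q p' q' u v :
  bideg p q u -> bideg p' q' v -> bideg (p + p') (q + q') (wedge u v).
Proof.
move=> hu hv I K h; rewrite ffunE big1 // => A /= AI; rewrite big1 // => B /= BK.
have [/andP[/eqP Ap /eqP Bq]|nu] := boolP ((#|A| == p) && (#|B| == q)); last first.
  by rewrite (hu _ _ nu) mulr0 mul0r.
rewrite (hv (I :\: A)) ?mulr0 //; apply: contra h => /andP[/eqP Ip /eqP Kq].
rewrite -(finset.cardsID A I) -(finset.cardsID B K) Ip Kq.
by rewrite (finset.setIidPr AI) (finset.setIidPr BK) Ap Bq !eqxx.
Qed.

Lemma bideg_contr_dxi p q j w : bideg p q.+1 w -> bideg p q (contr_dxi j w).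
Proof.
move=> hw I K h; rewrite contr_dxiE; case: ifP => // jK.
by rewrite hw ?mulr0 // cardsU1 jK add1n eqSS.
Qed.

Lemma bideg_contr_dx p q j w : bideg p.+1 q w -> bideg p q (contr_dx j w).
Proof.
move=> hw I K h; rewrite contr_dxE; case: ifP => // jI.
by rewrite hw ?mulr0 // cardsU1 jI add1n eqSS.
Qed.

Lemma bideg_gtr p q w : (n < q)%N -> bideg p q w -> w = 0.
Proof.
move=> nq hw; apply: extP => I K; rewrite ext0 hw // negb_and; apply/orP; right.
by apply: contraL nq => /eqP <-; rewrite -leqNgt -[leqRHS]card_ord max_card.
Qed.

Lemma parity_dx j : parity (dx R j) = - dx R j.
Proof.
apply: extP => I K; rewrite parityE extN monoE.
do 2 case: eqP => [->|_]; rewrite ?cards1 ?cards0 ?mulr0 ?oppr0 //.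
by rewrite addn0 expr1 mulN1r.
Qed.

Lemma wedge_dx_dx i j w :
  wedge (dx R i) (wedge (dx R j) w) = - wedge (dx R j) (wedge (dx R i) w).
Proof. by rewrite !wedgeA wedge_dxC parity_dx !wedgeNl. Qed.

Lemma wedge_dxi_dx i j w :
  wedge (dxi R i) (wedge (dx R j) w) = - wedge (dx R j) (wedge (dxi R i) w).
Proof. by rewrite !wedgeA wedge_dxiC parity_dx !wedgeNl. Qed.

Lemma ext_J_dx i w : ext_J (wedge (dx R i) w) = wedge (dx R i) (ext_J w).
Proof.
rewrite /ext_J wedge_sumr; apply: eq_bigr => j _.
by rewrite contr_dxi_wedge_dx wedgeNr wedge_dx_dx opprK.
Qed.

(** Contracting the new factor dxi_i contributes dx_i; the other contractions pass it with two sign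
    changes. *)
Lemma ext_J_dxi i w :
  ext_J (wedge (dxi R i) w) = wedge (dx R i) w + wedge (dxi R i) (ext_J w).
Proof.
have -> : wedge (dx R i) w = \sum_j (i == j)%:R *: wedge (dx R j) w.
  rewrite (bigD1 i) //= eqxx scale1r big1 ?addr0 // => j.
  by rewrite eq_sym => /negPf ->; rewrite scale0r.
rewrite /ext_J wedge_sumr -big_split; apply: eq_bigr => j _ /=.
by rewrite contr_dxi_wedge_dxi wedgeDr wedgeNr wedgeZr wedge_dxi_dx.
Qed.

Lemma ext_J_oneform a w : ext_J (wedge (oneform a) w) = wedge (oneform a) (ext_J w).
Proof.
rewrite /oneform !wedge_suml ext_J_sum; apply: eq_bigr => i _.
by rewrite !wedgeZl ext_JZ ext_J_dx.
Qed.

Lemma ext_J_oneform_sharp a w : ext_J (wedge (oneform_sharp a) w) =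
  wedge (oneform a) w + wedge (oneform_sharp a) (ext_J w).
Proof.
rewrite /oneform /oneform_sharp !wedge_suml ext_J_sum -big_split.
by apply: eq_bigr => i _ /=; rewrite !wedgeZl ext_JZ ext_J_dxi scalerDr.
Qed.

Definition elem1 (a : 'rV[R]_n) : ext := wedge (oneform a) (oneform_sharp a).

Lemma parity_oneform a : parity (oneform a) = - oneform a.
Proof.
apply: extP => I K; rewrite parityE extN /oneform sum_ffunE mulr_sumr -sumrN.
by apply: eq_bigr => j _; rewrite extZ mulrCA -parityE parity_dx extN mulrN.
Qed.

Lemma wedge_oneformC a u : wedge (oneform a) u = wedge (parity u) (oneform a).
Proof.
rewrite /oneform wedge_suml wedge_sumr; apply: eq_bigr => j _.
by rewrite wedgeZl wedgeZr wedge_dxC.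
Qed.

Lemma wedge_oneform_sharpC a u :
  wedge (oneform_sharp a) u = wedge (parity u) (oneform_sharp a).
Proof.
rewrite /oneform_sharp wedge_suml wedge_sumr; apply: eq_bigr => j _.
by rewrite wedgeZl wedgeZr wedge_dxiC.
Qed.

Lemma wedge_oneform_sq a : wedge (oneform a) (oneform a) = 0.
Proof.
have := wedge_oneformC a (oneform a); rewrite parity_oneform wedgeNl.
move=> /eqP; rewrite -addr_eq0 -mulr2n -scaler_nat scaler_eq0.
by rewrite pnatr_eq0 /= => /eqP.
Qed.

(** The derivation sends a /\ a# to a /\ a = 0, so this factor is a constant for [ext_J]. *)
Lemma ext_J_elem1 a w : ext_J (wedge (elem1 a) w) = wedge (elem1 a) (ext_J w).
Proof.
rewrite /elem1 -!wedgeA ext_J_oneform ext_J_oneform_sharp wedgeDr.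
by rewrite wedgeA wedge_oneform_sq wedge0l add0r.
Qed.

Lemma wedge_elem1C a u : wedge (elem1 a) u = wedge u (elem1 a).
Proof.
rewrite /elem1 -wedgeA wedge_oneform_sharpC wedgeA wedge_oneformC parityK.
by rewrite -wedgeA.
Qed.

Lemma elementary0 (a : 'I_0 -> 'rV[R]_n) : elementary a = ext1 R n.
Proof. by rewrite /elementary big_ord0. Qed.

Lemma elementaryS q (a : 'I_q.+1 -> 'rV[R]_n) :
  elementary a = wedge (elem1 (a ord0)) (elementary (fun i : 'I_q => a (lift ord0 i))).
Proof. by rewrite /elementary big_ord_recl. Qed.

Lemma ext_J_elementary q (a : 'I_q -> 'rV[R]_n) w :
  ext_J (wedge (elementary a) w) = wedge (elementary a) (ext_J w).
Proof.
elim: q a w => [|q IH] a w; first by rewrite elementary0 !wedge1l.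
by rewrite elementaryS -wedgeA ext_J_elem1 IH wedgeA.
Qed.

Lemma wedge_elementaryC q (a : 'I_q -> 'rV[R]_n) w :
  wedge (elementary a) w = wedge w (elementary a).
Proof.
elim: q a w => [|q IH] a w; first by rewrite elementary0 wedge1l wedge1r.
by rewrite elementaryS -(wedgeA (elem1 _)) IH wedgeA wedge_elem1C -wedgeA.
Qed.

Lemma bideg_oneform a : bideg 1 0 (oneform a).
Proof. by apply: bideg_sum => j _; apply: bidegZ; exact: bideg_dx. Qed.

Lemma bideg_oneform_sharp a : bideg 0 1 (oneform_sharp a).
Proof. by apply: bideg_sum => j _; apply: bidegZ; exact: bideg_dxi. Qed.

Lemma bideg_elem1 a : bideg 1 1 (elem1 a).
Proof. exact: (bideg_wedge (@bideg_oneform a) (@bideg_oneform_sharp a)). Qed.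

Lemma bideg_elementary q (a : 'I_q -> 'rV[R]_n) : bideg q q (elementary a).
Proof.
elim: q a => [|q IH] a.
  by have := @bideg_mono finset.set0 finset.set0; rewrite elementary0 cards0.
rewrite elementaryS; exact: (bideg_wedge (@bideg_elem1 _) (@IH _)).
Qed.

End ElementaryForms.

(** * Decomposition of (q, q)-forms into strong forms and images of [ext_J] *)

Section StrongForms.
Variables (R : realType) (n : nat).
Local Notation ext := (extalg R n).
Implicit Types (u v w : ext) (a : 'rV[R]_n) (i j k : 'I_n) (I J K : {set 'I_n}).

(** Finite combinations are built like lists, so that linear statements about strong forms are
    inductions treating one elementary term at a time. *)
Inductive strong_ext (q : nat) : ext -> Prop :=
| strong_ext0 : strong_ext q 0
| strong_ext_cons (c : R) (a : 'I_q -> 'rV[R]_n) w :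
    strong_ext q w -> strong_ext q (c *: elementary a + w).

Lemma strong_extD q u v : strong_ext q u -> strong_ext q v -> strong_ext q (u + v).
Proof.
by elim=> [|c a w _ IH] hv; rewrite ?add0r // -addrA; constructor; exact: IH.
Qed.

Lemma strong_extZ q (c : R) u : strong_ext q u -> strong_ext q (c *: u).
Proof.
elim=> [|d a w _ IH]; first by rewrite scaler0; constructor.
by rewrite scalerDr scalerA; constructor.
Qed.

Lemma strong_elementary q (a : 'I_q -> 'rV[R]_n) : strong_ext q (elementary a).
Proof. by rewrite -[elementary a]addr0 -[elementary a]scale1r; do 2 constructor. Qed.

Lemma strong_ext_elem1 q a w : strong_ext q w -> strong_ext q.+1 (wedge (elem1 a) w).
Proof.
elim=> [|c b w' _ IH]; first by rewrite wedge0r; constructor.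
rewrite wedgeDr wedgeZr; apply: strong_extD IH; apply: strong_extZ.
pose ab (i : 'I_q.+1) := if unlift ord0 i is Some j then b j else a.
suff -> : wedge (elem1 a) (elementary b) = elementary ab by exact: strong_elementary.
rewrite elementaryS /ab unlift_none; congr (wedge _ (elementary _)).
by apply/funext => i; rewrite liftK.
Qed.

Lemma bideg_strong_ext q w : strong_ext q w -> bideg q q w.
Proof.
elim=> [|c a w' _ IH]; first exact: bideg0.
by apply: bidegD IH; apply: bidegZ; exact: bideg_elementary.
Qed.

Lemma ext_J_strong q e w : strong_ext q e -> ext_J (wedge e w) = wedge e (ext_J w).
Proof.
elim=> [|c a e' _ IH]; first by rewrite !wedge0l ext_J0.
by rewrite !wedgeDl !wedgeZl ext_JD ext_JZ ext_J_elementary IH.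
Qed.

(* The polarization of [elem1]. *)
Definition sym2 i j : ext := wedge (dx R i) (dxi R j) + wedge (dx R j) (dxi R i).

Lemma oneform_delta i : oneform (delta_mx 0 i : 'rV[R]_n) = dx R i.
Proof.
rewrite /oneform (bigD1 i) //= mxE !eqxx scale1r big1 ?addr0 // => j /negPf ji.
by rewrite mxE eqxx ji scale0r.
Qed.

Lemma oneform_sharp_delta i : oneform_sharp (delta_mx 0 i : 'rV[R]_n) = dxi R i.
Proof.
rewrite /oneform_sharp (bigD1 i) //= mxE !eqxx scale1r big1 ?addr0 // => j /negPf ji.
by rewrite mxE eqxx ji scale0r.
Qed.

Lemma oneformD a b : oneform (a + b) = oneform a + oneform b.
Proof.
by rewrite /oneform -big_split; apply: eq_bigr => j _; rewrite mxE scalerDl.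
Qed.

Lemma oneform_sharpD a b : oneform_sharp (a + b) = oneform_sharp a + oneform_sharp b.
Proof.
by rewrite /oneform_sharp -big_split; apply: eq_bigr => j _; rewrite mxE scalerDl.
Qed.

Lemma sym2E i j : sym2 i j = elem1 (delta_mx 0 i + delta_mx 0 j)
  - elem1 (delta_mx 0 i) - elem1 (delta_mx 0 j).
Proof.
rewrite /elem1 oneformD oneform_sharpD !oneform_delta !oneform_sharp_delta.
have -> u u' v v' : wedge (u + v) (u' + v') - wedge u u' - wedge v v' =
    wedge u v' + wedge v u'.
  rewrite wedgeDl !wedgeDr; move: (wedge u u') (wedge v v') => x y.
  by rewrite (AC (2*2) (2*3*4*1)) /= !addrK.
by [].
Qed.

Lemma strong_ext_sym2 q i j w : strong_ext q w -> strong_ext q.+1 (wedge (sym2 i j) w).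
Proof.
move=> hw; rewrite sym2E !wedgeDl !wedgeNl -[- wedge _ w]scaleN1r
  -[- wedge (elem1 (delta_mx 0 j)) w]scaleN1r.
by do ![apply: strong_extD | apply: strong_extZ | apply: strong_ext_elem1].
Qed.

Lemma ext_JN u : ext_J (- u) = - ext_J u.
Proof. by rewrite -[in LHS]scaleN1r ext_JZ scaleN1r. Qed.

Lemma ext_J_sym2 i j w : ext_J (wedge (sym2 i j) w) = wedge (sym2 i j) (ext_J w).
Proof.
by rewrite sym2E !wedgeDl !wedgeNl !ext_JD !ext_JN !ext_J_elem1.
Qed.

Lemma bideg_sym2 i j : bideg 1 1 (sym2 i j).
Proof.
by apply: bidegD; apply: (bideg_wedge (@bideg_dx _ _ _) (@bideg_dxi _ _ _)).
Qed.

(* For [q = 0] there is no room for [ext_J]: truncated subtraction would give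
   bidegree (0, 1) instead of (-1, 1). *)
Definition ext_J_dom q w : Prop := if q is q'.+1 then bideg q' q'.+2 w else w = 0.

(** Membership in E + im J. The bidegree of the primitive is recorded because later vanishing
    arguments count its dxi factors. *)
Definition strong_mod_J q w := exists e b : ext,
  [/\ strong_ext q e, ext_J_dom q b &
      w = e + ext_J b].

Lemma strong_mod_JD q u v :
  strong_mod_J q u -> strong_mod_J q v -> strong_mod_J q (u + v).
Proof.
move=> [e [b [he hb ->]]] [e' [b' [he' hb' ->]]]; exists (e + e'), (b + b').
split; [exact: strong_extD | | by rewrite ext_JD addrACA].
case: q hb hb' {he he'} => [-> ->|q]; [exact: addr0 | exact: bidegD].
Qed.

Lemma strong_mod_JZ q (c : R) u : strong_mod_J q u -> strong_mod_J q (c *: u).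
Proof.
move=> [e [b [he hb ->]]]; exists (c *: e), (c *: b).
split; [exact: strong_extZ | | by rewrite ext_JZ scalerDr].
case: q hb {he} => [->|q]; [exact: scaler0 | exact: bidegZ].
Qed.

Lemma strong_mod_J0 q : strong_mod_J q 0.
Proof.
exists 0, 0; split; [constructor | | by rewrite ext_J0 addr0].
by case: q => [//|q]; exact: bideg0.
Qed.

Lemma strong_mod_J_sum q (T : Type) (r : seq T) (P : pred T) (F : T -> ext) :
  (forall x, P x -> strong_mod_J q (F x)) ->
  strong_mod_J q (\sum_(i <- r | P i) F i).
Proof.
by move=> h; elim/big_ind: _ => //; [exact: strong_mod_J0 | exact: strong_mod_JD].
Qed.

(** Both summands survive: [sym2] is a combination of elementary forms and commutes with [ext_J].
    This carries the induction from [q] to [q.+1]. *)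
Lemma strong_mod_J_sym2 q i j w :
  strong_mod_J q w -> strong_mod_J q.+1 (wedge (sym2 i j) w).
Proof.
move=> [e [b [he hb ->]]]; exists (wedge (sym2 i j) e), (wedge (sym2 i j) b); split.
- exact: strong_ext_sym2.
- case: q hb {he} => [->|q hb]; first by rewrite wedge0r; exact: bideg0.
  exact: (bideg_wedge (@bideg_sym2 _ _) hb).
by rewrite ext_J_sym2 wedgeDr.
Qed.

(* Modulo symmetric factors, moving a [dxi] past [ext_J th] reproduces
   [dx i /\ th] with multiplicity the number of [dxi]'s in [th]. *)
Lemma ext_J_dxi_sym2 q i th : bideg q q.+1 th ->
  (q.+2%:R : R) *: wedge (dx R i) th =
  ext_J (wedge (dxi R i) th) + \sum_k wedge (sym2 k i) (contr_dxi k th).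
Proof.
move=> hth; rewrite ext_J_dxi.
have -> : wedge (dxi R i) (ext_J th) = q.+1%:R *: wedge (dx R i) th
    - \sum_k wedge (sym2 k i) (contr_dxi k th).
  (* The number operator acts on [th] as [q.+1]; written out as a sum it supplies the half dx_i /\
     dxi_k of each [sym2 k i]. *)
  have -> : (q.+1%:R : R) *: wedge (dx R i) th
      = wedge (dx R i) (\sum_k wedge (dxi R k) (contr_dxi k th)).
    rewrite -wedgeZr; congr (wedge _ _); apply: extP => I K.
    rewrite sum_wedge_dxi_contr extZ.
    have [/andP[_ /eqP ->] //|nIK] := boolP ((#|I| == q) && (#|K| == q.+1)).
    by rewrite hth ?mulr0.
  rewrite /ext_J !wedge_sumr -sumrB; apply: eq_bigr => k _.
  by rewrite wedge_dxi_dx /sym2 wedgeDl -!wedgeA opprD addrCA subrr addr0.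
rewrite -addrA addrNK -{2}[wedge _ th]scale1r -scalerDl.
by rewrite -[q.+2]addn1 natrD addrC.
Qed.

Lemma mono_dx i I K : i \in I ->
  mono R I K = sg R i (I :\ i) *: wedge (dx R i) (mono R (I :\ i) K).
Proof.
move=> iI; rewrite wedge_mono disjoints1 finset.setD11 -finset.setI_eq0.
rewrite finset.set0I eqxx /= finset.setD1K // finset.set0U scalerA.
by rewrite /wedge_sign cards0 mul0n ninv0l addn0 sgK scale1r.
Qed.

Lemma bideg_strong_mod_J q w : bideg q q w -> strong_mod_J q w.
Proof.
elim: q w => [|q IH] w hw.
  exists w, 0; split => //; last by rewrite ext_J0 addr0.
  (* A (0, 0)-form is a scalar, hence a multiple of the empty elementary product. *)
  suff -> : w = (w (finset.set0, finset.set0) : R) *: elementary (fun _ : 'I_0 => 0) + 0.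
    by do 2 constructor.
  rewrite addr0 elementary0; apply: extP => I K; rewrite extZ monoE.
  have [->|I0] := eqVneq I finset.set0; last by rewrite hw ?mulr0 ?cards_eq0 ?(negPf I0).
  have [->|K0] := eqVneq K finset.set0; first by rewrite mulr1.
  by rewrite hw ?mulr0 ?cards_eq0 ?(negPf K0) ?andbF.
rewrite (ext_sum_mono w); apply: strong_mod_J_sum => I _.
apply: strong_mod_J_sum => K _.
have [/andP[/eqP hI /eqP hK]|nIK] := boolP ((#|I| == q.+1) && (#|K| == q.+1)); last first.
  by rewrite hw // scale0r; exact: strong_mod_J0.
have [i iI] : exists i, i \in I by apply/finset.set0Pn; rewrite -cards_eq0 hI.
rewrite (mono_dx K iI); do 2 apply: strong_mod_JZ.
set th := mono _ _ _.
have hth : bideg q q.+1 th.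
  have := @bideg_mono R n (I :\ i) K; rewrite hK.
  by have := cardsD1 i I; rewrite iI hI add1n => -[<-].
(* Dividing by [q.+2] leaves an image of [ext_J] plus symmetric factors times (q, q)-forms, to which
   the induction hypothesis applies. *)
have q0 : (q.+2%:R : R) != 0 by rewrite pnatr_eq0.
have -> : wedge (dx R i) th = (q.+2%:R^-1 : R) *: ((q.+2%:R : R) *: wedge (dx R i) th).
  by rewrite scalerA mulVf // scale1r.
apply: strong_mod_JZ; rewrite (ext_J_dxi_sym2 _ hth); apply: strong_mod_JD.
  exists 0, (wedge (dxi R i) th); split; [constructor | | by rewrite add0r].
  exact: (bideg_wedge (@bideg_dxi _ _ _) hth).
apply: strong_mod_J_sum => k _; apply: strong_mod_J_sym2; apply: IH.
exact: bideg_contr_dxi.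
Qed.

End StrongForms.

(** * Duality between complementary bidegrees and transposition of coefficients *)

Section WedgeDuality.
Variables (R : realType) (n : nat).
Local Notation ext := (extalg R n).
Implicit Types (u v w : ext) (a : 'rV[R]_n) (i j k : 'I_n) (I J K : {set 'I_n}).

(** Against the monomial complementary to (I, K), the top coefficient of the product is the
    coefficient of [w] at (I, K) up to sign. *)
Lemma wedge_nondegenerate q w : bideg q q w ->
  (forall I K, #|I| = q -> #|K| = q -> wedge w (mono R (~: I) (~: K)) = 0) -> w = 0.
Proof.
move=> bw hw; apply: extP => I K; rewrite ext0.
have [/andP[/eqP hI /eqP hK]|/bw//] := boolP ((#|I| == q) && (#|K| == q)).
have : wedge w (mono R (~: I) (~: K)) ([set: 'I_n], [set: 'I_n]) = 0 :> R.
  by rewrite hw // ext0.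
have setTDI (A B : {set 'I_n}) : (finset.setT :\: A == ~: B) = (A == B).
  by rewrite finset.setTD (inj_eq (can_inj (@finset.setCK _))).
rewrite ffunE (bigD1 I) ?finset.subsetT //= (bigD1 K) ?finset.subsetT //=.
rewrite monoE !setTDI !eqxx mulr1 !big1 ?addr0.
- by move/eqP; rewrite mulf_eq0 signr_eq0 /= => /eqP.
- move=> A /andP[_ /negPf AI]; rewrite big1 // => B _.
  by rewrite monoE !setTDI AI mulr0.
by move=> B /andP[_ /negPf BK]; rewrite monoE !setTDI BK andbF mulr0.
Qed.

(** Multiplication by [e] commutes with [ext_J], and e /\ b would have p + q + 1 = n + 1 factors
    dxi. *)
Lemma wedge_strong_ext_J p q (e b : ext) : (p + q = n)%N -> strong_ext p e ->
  ext_J_dom q b -> wedge e (ext_J b) = 0.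
Proof.
move=> pq he; case: q pq => [_ ->|q pq hb]; first by rewrite ext_J0 wedge0r.
rewrite -(ext_J_strong _ he) (@bideg_gtr _ _ (p + q) (p + q.+2) (wedge e b)) ?ext_J0 //.
  by rewrite -[X in (X < _)%N]pq ltn_add2l.
exact: (bideg_wedge (bideg_strong_ext he) hb).
Qed.

Lemma wedge_strongC q (e w : ext) : strong_ext q e -> wedge e w = wedge w e.
Proof.
elim=> [|c a e' _ IH]; first by rewrite wedge0l wedge0r.
by rewrite wedgeDl wedgeDr IH wedgeZl wedgeZr wedge_elementaryC.
Qed.

(** Each complementary monomial is an elementary combination plus an image of [ext_J]; the product
    of [e] with the first vanishes by hypothesis, with the second by degree. *)
Lemma strong_ext_eq0 p q (e : ext) : (p + q = n)%N -> strong_ext q e ->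
  (forall a : 'I_p -> 'rV[R]_n, wedge e (elementary a) = 0) -> e = 0.
Proof.
move=> pq he hea; apply: (wedge_nondegenerate (bideg_strong_ext he)) => I K hI hK.
have hp (A : {set 'I_n}) : #|A| = q -> #|~: A| = p.
  by have := finset.cardsC A; rewrite card_ord; lia.
have := @bideg_mono R n (~: I) (~: K); rewrite !hp //.
move=> /bideg_strong_mod_J[f [b [hf hb ->]]].
rewrite wedgeDr (wedge_strong_ext_J _ he hb) ?addr0 1?addnC //.
elim: hf => [|c a f' _ IH]; first exact: wedge0r.
by rewrite wedgeDr IH wedgeZr hea scaler0 addr0.
Qed.

(** The family [b] does not depend on [w]: one choice per monomial, extended linearly, handles all
    values of a test form at once. *)
Lemma ext_J_section p q : (p + q = n)%N ->
  exists b : {set 'I_n} * {set 'I_n} -> ext,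
    (forall L, ext_J_dom q (b L)) /\
    forall w, bideg q q w ->
      (forall a : 'I_p -> 'rV[R]_n, wedge w (elementary a) = 0) ->
      w = ext_J (\sum_L (w L : R) *: b L).
Proof.
move=> pq; have : forall L : {set 'I_n} * {set 'I_n}, exists b : ext,
    ext_J_dom q b /\
    (#|L.1| = q -> #|L.2| = q -> strong_ext q (mono R L.1 L.2 - ext_J b)).
  move=> [I K] /=.
  have [/andP[/eqP hI /eqP hK]|] := boolP ((#|I| == q) && (#|K| == q)); last first.
    move=> nIK; exists 0; split; first by case: (q) => [//|q']; exact: bideg0.
    by move=> hI hK; move: nIK; rewrite hI hK !eqxx.
  have := @bideg_mono R n I K; rewrite hI hK => /bideg_strong_mod_J[e [b [he hb ->]]].
  by exists b; split => // _ _; rewrite addrK.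
move=> /choice[b hb]; exists b; split => [L|w hw hwa]; first by have [] := hb L.
set c := \sum_L _; apply/eqP; rewrite -subr_eq0; apply/eqP.
have hc : ext_J_dom q c.
  case: (q) hb => [|q'] hb.
    by rewrite /c big1 // => L _; have [-> _] := hb L; rewrite scaler0.
  by apply: bideg_sum => L _; apply: bidegZ; have [] := hb L.
(* The defect [w - ext_J c] is strong by the choice of [b], and its products with elementary forms
   still vanish. *)
apply: (strong_ext_eq0 pq).
  have -> : w - ext_J c = \sum_L (w L : R) *: (mono R L.1 L.2 - ext_J (b L)).
    rewrite {1}(ext_sum_mono w) pair_big /= /c ext_J_sum -sumrB.
    by apply: eq_bigr => -[I K] _; rewrite ext_JZ scalerBr.
  elim/big_ind: _ => [|u v|[I K] _]; [constructor | exact: strong_extD |].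
  have [/andP[/eqP hI /eqP hK]|nIK] := boolP ((#|I| == q) && (#|K| == q)).
    by apply: strong_extZ; have [_] := hb (I, K); apply.
  by rewrite hw // scale0r; constructor.
move=> a; rewrite wedgeDl hwa add0r wedgeNl -(wedge_strongC _ (strong_elementary a)).
by rewrite (wedge_strong_ext_J pq (strong_elementary a) hc) oppr0.
Qed.

(** Transposition of the coefficient matrix, so its fixed points are the symmetric forms. On
    bidegree (p, q) it is (-1)^(pq) times the algebra automorphism exchanging dx and dxi. *)
Definition swap w : ext := [ffun J : {set 'I_n} * {set 'I_n} => w (J.2, J.1)].

Lemma swapE w I K : swap w (I, K) = w (K, I) :> R.
Proof. by rewrite ffunE. Qed.

Lemma bideg_swap p q w : bideg p q w -> bideg q p (swap w).
Proof. by move=> hw I K h; rewrite swapE hw // andbC. Qed.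

(* Off the diagonal bidegrees, [swap] is multiplicative only up to sign. *)
Lemma swap_wedge p q u v : bideg p p u -> bideg q q v ->
  swap (wedge u v) = wedge (swap u) (swap v).
Proof.
move=> hu hv; apply: extP => I K; rewrite swapE !ffunE /= exchange_big /=.
apply: eq_bigr => A AI; apply: eq_bigr => B BK; rewrite !swapE.
have [/andP[/eqP hB /eqP hA]|/hu ->] := boolP ((#|B| == p) && (#|A| == p)); last first.
  by rewrite !(mulr0, mul0r).
have [/andP[/eqP hB' /eqP hA']|/hv ->] :=
  boolP ((#|K :\: B| == q) && (#|I :\: A| == q)); last by rewrite !mulr0.
congr (_ * _ * _); rewrite /wedge_sign hA hB hA' hB'; congr (_ ^+ _).
by rewrite -!addnA [X in (_ + X)%N]addnC.
Qed.

Lemma swap_elementary q (a : 'I_q -> 'rV[R]_n) : swap (elementary a) = elementary a.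
Proof.
elim: q a => [|q IH] a.
  by rewrite elementary0; apply: extP => I K; rewrite swapE !monoE andbC.
rewrite elementaryS (swap_wedge (@bideg_elem1 _ _ _) (@bideg_elementary _ _ _ _)) IH.
congr (wedge _ _); apply: extP => I K; rewrite swapE /elem1 /oneform !wedge_suml.
have elemE A B : (\sum_i wedge (a ord0 0 i *: dx R i) (oneform_sharp (a ord0))) (A, B) =
    \sum_i \sum_j a ord0 0 i * a ord0 0 j * ((A == [set i]) && (B == [set j]))%:R :> R.
  rewrite sum_ffunE; apply: eq_bigr => i _; rewrite /oneform_sharp wedge_sumr sum_ffunE.
  apply: eq_bigr => j _; rewrite wedgeZl wedgeZr !extZ wedge_mono.
  rewrite -!finset.setI_eq0 finset.set0I finset.setI0 eqxx /= finset.setU0 finset.set0U.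
  by rewrite extZ monoE /wedge_sign cards0 ninv0l ninv0r mul0n expr0 mul1r mulrA.
rewrite !elemE exchange_big; apply: eq_bigr => i _; apply: eq_bigr => j _.
by rewrite andbC (mulrC (a ord0 0 j)).
Qed.

(** The only possible coefficient of the product is the top one, which [swap] fixes, while [swap]
    changes the sign of the product. *)
Lemma wedge_antisym_elementary p q w (a : 'I_p -> 'rV[R]_n) : (p + q = n)%N ->
  bideg q q w -> swap w = - w -> wedge w (elementary a) = 0.
Proof.
move=> pq hw sw; have hwa := bideg_wedge hw (@bideg_elementary _ _ _ a).
apply: extP => I K; rewrite ext0.
have [/andP[/eqP hI /eqP hK]|/hwa//] := boolP ((#|I| == q + p)%N && (#|K| == q + p)%N).
have eT (A : {set 'I_n}) : #|A| = (q + p)%N -> A = [set: 'I_n].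
  by move=> hA; apply/eqP; rewrite finset.eqEcard finset.subsetT cardsT card_ord hA addnC pq leqnn.
rewrite (eT I hI) (eT K hK); apply/eqP.
have := swapE (wedge w (elementary a)) [set: 'I_n] [set: 'I_n].
rewrite (swap_wedge hw (@bideg_elementary _ _ _ a)) swap_elementary sw wedgeNl extN.
by move=> /eqP; rewrite eq_sym -addr_eq0 -mulr2n mulrn_eq0.
Qed.

(** The transposed form has [q] factors dx, which [contr_dxi] must pass; hence the sign. *)
Lemma contr_dxi_swap p q j w : bideg p q w ->
  contr_dxi j (swap w) = (-1 : R) ^+ q *: swap (contr_dx j w).
Proof.
move=> hw; apply: extP => I K; rewrite extZ contr_dxiE !swapE contr_dxE.
case: ifP => jK; first by rewrite mulr0.
have [/andP[_ /eqP ->]|h] := boolP ((#|j |: K| == p) && (#|I| == q)).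
  by rewrite mulrA.
by rewrite hw // !mulr0.
Qed.

End WedgeDuality.

(** * Smooth functions *)

Local Open Scope classical_set_scope.

(** * Derivatives along lines, mean values and mixed derivatives *)

Section DirectionalDerivatives.
Variables (R : realType) (V : normedModType R).
Implicit Types (f : V -> R) (x v w : V) (t h : R).

Lemma is_derive_line f x v t : derivable f (x + t *: v) v ->
  is_derive t (1 : R) (fun s : R => f (x + s *: v)) ('D_v f (x + t *: v)).
Proof.
move=> df.
have E : (fun h : R => h^-1 *: (((fun s : R => f (x + s *: v)) \o shift t) (h *: (1 : R))
    - f (x + t *: v))) =
    (fun h : R => h^-1 *: ((f \o shift (x + t *: v)) (h *: v) - f (x + t *: v))).
  apply/funext => h /=; congr (_ *: (f _ - _)).
  by rewrite [h *: 1]mulr1 scalerDl addrCA addrA addrC.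
by split; rewrite /derivable /derive E.
Qed.

Lemma is_derive_line_at0 f x v : derivable f x v ->
  is_derive (0 : R) (1 : R) (fun s : R => f (x + s *: v)) ('D_v f x).
Proof.
have e0 : x + (0 : R) *: v = x by rewrite scale0r addr0.
by rewrite -{1 3}e0; exact: is_derive_line.
Qed.

(** Restriction to a line gives the one-dimensional theorem. The bound |c| <= |h| covers both signs
    of [h] and suffices for limits. *)
Lemma derive_mean_value f x v h : (forall y, derivable f y v) ->
  exists2 c, `|c| <= `|h| & f (x + h *: v) - f x = h * 'D_v f (x + c *: v).
Proof.
move=> df; pose g s := f (x + s *: v).
have dg t : is_derive t (1 : R) g ('D_v f (x + t *: v)) by apply: is_derive_line.
have cg (A : set R) : {within A, continuous g}.
  apply: continuous_subspaceT => t; apply/differentiable_continuous/derivable1_diffP.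
  by have [] := dg t.
have g0 : g 0 = f x by rewrite /g scale0r addr0.
have [h0|h0] := leP 0 h.
  have [c] := MVT_segment h0 (fun t _ => dg t) (@cg _).
  rewrite in_itv /= g0 subr0 => /andP[c0 ch] E; exists c.
    by rewrite !ger0_norm.
  by rewrite -/(g h) E mulrC.
have [c] := MVT_segment (ltW h0) (fun t _ => dg t) (@cg _).
rewrite in_itv /= g0 sub0r => /andP[hc c0] E; exists c.
  by rewrite !ler0_norm ?lerN2 // ltW.
by rewrite -/(g h) -opprB E mulrN opprK mulrC.
Qed.

(** Only directional derivatives are given, so the increment along [h *: w] is evaluated by the mean
    value theorem at a point tending to [x], where ['D_w f] is continuous. *)
Lemma is_derive_addv f x v w : derivable f x v -> (forall y, derivable f y w) ->
  {for x, continuous ('D_w f)} ->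
  is_derive x (v + w) f ('D_v f x + 'D_w f x).
Proof.
move=> dv dw cw.
suff H : h^-1 *: ((f \o shift x) (h *: (v + w)) - f x) @[h --> 0^'] -->
    'D_v f x + 'D_w f x.
  by split; [apply/cvg_ex; eexists; exact: H | exact: cvg_lim H].
have /choice[c hc] : forall h : R, exists c : R, `|c| <= `|h| /\
    f (x + h *: v + h *: w) - f (x + h *: v) = h * 'D_w f (x + h *: v + c *: w).
  by move=> h; have [c] := derive_mean_value (x + h *: v) h dw; exists c.
have E : \forall h \near 0^', h^-1 *: ((f \o shift x) (h *: v) - f x) +
    'D_w f (x + h *: v + c h *: w) =
    h^-1 *: ((f \o shift x) (h *: (v + w)) - f x).
  near=> h; have h0 : h != 0 by near: h; exact: nbhs_dnbhs_neq.
  have [_ fh] := hc h.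
  have -> : (f \o shift x) (h *: (v + w)) = h * 'D_w f (x + h *: v + c h *: w)
      + (f \o shift x) (h *: v).
    rewrite /= scalerDr [h *: v + h *: w + x]addrC addrA [h *: v + x]addrC.
    by move/eqP: fh; rewrite subr_eq => /eqP.
  set A := 'D_w f _; set B := (f \o _) _.
  by rewrite -addrA [in RHS]scalerDr [h^-1 *: (h * A)]mulKf // [LHS]addrC.
apply: cvg_trans (near_eq_cvg E) _; apply: cvgD; first exact: dv.
apply: (@cvg_comp _ _ _ (fun h => x + h *: v + c h *: w) ('D_w f) _ (nbhs x)) => //.
have id0 : h @[h --> (0 : R)^'] --> (0 : R) by exact: nbhs_dnbhs.
have c0 : c h @[h --> 0^'] --> (0 : R).
  apply: norm_cvg0; apply: (@squeeze_cvgr _ _ _ _ (cst 0) (fun h : R => `|h|)).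
  - by near=> h; rewrite normr_ge0 /=; have [] := hc h.
  - exact: cvg_cst.
  - by apply/norm_cvg0P.
suff : (fun h : R => x + h *: v + c h *: w) h @[h --> 0^'] --> x + (0 : R) *: v + (0 : R) *: w.
  by rewrite !scale0r !addr0.
by apply: cvgD; [apply: cvgD; [exact: cvg_cst|exact: cvgZr_tmp]|exact: cvgZr_tmp].
Unshelve. all: by end_near. Qed.

Lemma is_derive_line0 f x v (d : R) :
  is_derive (0 : R) (1 : R) (fun s : R => f (x + s *: v)) d -> is_derive x v f d.
Proof.
have E : (fun h : R => h^-1 *: (((fun s : R => f (x + s *: v)) \o shift 0) (h *: (1 : R))
    - f (x + 0 *: v))) =
    (fun h : R => h^-1 *: ((f \o shift x) (h *: v) - f x)).
  by apply/funext => h /=; rewrite scale0r !addr0 [h *: 1]mulr1 [x + _]addrC.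
by case; rewrite /derivable /derive E => h1 h2; split.
Qed.

Lemma is_derive_scalev f x v (k : R) : derivable f x v ->
  is_derive x (k *: v) f (k * 'D_v f x).
Proof.
move=> dv; apply: is_derive_line0.
have -> : (fun s : R => f (x + s *: (k *: v))) =
    (fun s => f (x + s *: v)) \o (fun s : R => s * k).
  by apply/funext => s /=; rewrite scalerA.
have e0 : x + (0 * k : R) *: v = x by rewrite mul0r scale0r addr0.
rewrite mulrC -[in 'D_v f x]e0; apply: is_derive1_comp.
  by apply: is_derive_line; rewrite e0.
have -> : (fun s : R => s * k) = k *: (id : R -> R) by apply/funext => s /=; rewrite mulrC.
by apply: is_derive_eq; rewrite [k *: 1]mulr1.
Qed.

Lemma derive_scale_arg f (k : R) x v : derivable f (k *: x) v ->
  is_derive x v (fun y => f (k *: y)) (k * 'D_v f (k *: x)).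
Proof.
move=> dv; apply: is_derive_line0.
have -> : (fun s : R => f (k *: (x + s *: v))) = (fun s : R => f (k *: x + s *: (k *: v))).
  by apply/funext => s; rewrite scalerDr !scalerA mulrC.
have [dk <-] := is_derive_scalev k dv.
exact: is_derive_line_at0.
Qed.

(* Both mixed derivatives are limits of the same second difference quotient. *)
Lemma derive_comm f v w x :
  (forall y, derivable f y v) -> (forall y, derivable f y w) ->
  (forall y, derivable ('D_v f) y w) -> (forall y, derivable ('D_w f) y v) ->
  {for x, continuous ('D_w ('D_v f))} -> {for x, continuous ('D_v ('D_w f))} ->
  'D_w ('D_v f) x = 'D_v ('D_w f) x.
Proof.
have tri (P Q Y e : R) : `|P - Y| < e -> `|Q - Y| < e -> `|P - Q| < e + e.
  move=> PY QY; rewrite -(subrKA Y); apply: le_lt_trans (ler_normD _ _) _.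
  by apply: ltrD => //; rewrite distrC.
(* The second difference is the increment along [a] of [g y = f (y + h *: b) - f y]; the mean value
   theorem is used first along [a], then along [b]. *)
have diff2 a b (h : R) : (forall y, derivable f y a) ->
    (forall y, derivable ('D_a f) y b) ->
    exists c d : R, [/\ `|c| <= `|h|, `|d| <= `|h| &
      f (x + h *: a + h *: b) - f (x + h *: b) - (f (x + h *: a) - f x) =
      h * (h * 'D_b ('D_a f) (x + c *: a + d *: b))].
  move=> da dab; pose g y := f (y + h *: b) - f y.
  have dg y : is_derive y a g ('D_a f (y + h *: b) - 'D_a f y).
    apply: is_deriveB; apply: is_derive_line0.
      have -> : (fun s : R => f (y + s *: a + h *: b)) = (fun s : R => f (y + h *: b + s *: a)).
        by apply/funext => s; rewrite addrAC.
      exact: is_derive_line_at0.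
    exact: is_derive_line_at0.
  have [c ch E] := derive_mean_value x h (fun y => @ex_derive _ _ _ _ _ _ _ (dg y)).
  have [d dh E'] := derive_mean_value (x + c *: a) h dab.
  exists c, d; split => //; rewrite -E'.
  move: E; rewrite (@derive_val _ _ _ _ _ _ _ (dg _)) /g => <-.
  move: (f (x + h *: a + h *: b)) (f (x + h *: a)) (f (x + h *: b)) (f x) => *; ring.
move=> dv dw dvw dwv cvw cwv; apply/eqP/negPn/negP => ne.
pose e := `|'D_w ('D_v f) x - 'D_v ('D_w f) x| / 2.
have e0 : 0 < e by rewrite divr_gt0 // normr_gt0 subr_eq0.
have ee : e + e = `|'D_w ('D_v f) x - 'D_v ('D_w f) x|.
  by rewrite -mulr2n -mulr_natr divfK.
clearbody e.
have /cvgrPdist_lt /(_ e e0) /nbhs_ballP[r1 /= r10 H1] := cvw.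
have /cvgrPdist_lt /(_ e e0) /nbhs_ballP[r2 /= r20 H2] := cwv.
(* The summand 1 keeps [m] positive even for zero directions; [h] is then small enough for all
   intermediate points to lie in both balls. *)
pose m := `|v| + `|w| + 1.
have m0 : 0 < m by rewrite ltr_wpDl // addr_ge0.
pose h := Num.min r1 r2 / m / 2.
have h0 : 0 < h by rewrite !divr_gt0 // lt_min r10 r20.
have small (a b : V) (c d : R) : `|c| <= `|h| -> `|d| <= `|h| -> `|a| + `|b| < m ->
    `|x - (x + c *: a + d *: b)| < Num.min r1 r2.
  move=> ch dh ab; rewrite -addrA opprD addrA subrr add0r normrN.
  apply: le_lt_trans (ler_normD _ _) _; rewrite !normrZ.
  apply: (@le_lt_trans _ _ (h * (`|a| + `|b|))).
    by rewrite mulrDr lerD // ler_wpM2r // -[leRHS](gtr0_norm h0).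
  apply: (@lt_trans _ _ (h * m)); first by rewrite ltr_pM2l.
  rewrite /h mulrAC divfK ?gt_eqF // ltr_pdivrMr // ltr_pMr ?lt_min ?r10 ?r20 //.
  by rewrite ltr1n.
have [c [d [ch dh E]]] := diff2 v w h dv dvw.
have [c' [d' [ch' dh' E']]] := diff2 w v h dw dwv.
have vw : `|v| + `|w| < m by rewrite ltrDl.
have wv : `|w| + `|v| < m by rewrite addrC.
have B1 : `|'D_w ('D_v f) x - 'D_w ('D_v f) (x + c *: v + d *: w)| < e.
  apply: H1; rewrite -ball_normE /=.
  by apply: lt_le_trans (small v w c d ch dh vw) _; rewrite ge_min lexx.
have B2 : `|'D_v ('D_w f) x - 'D_v ('D_w f) (x + c' *: w + d' *: v)| < e.
  apply: H2; rewrite -ball_normE /=.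
  by apply: lt_le_trans (small w v c' d' ch' dh' wv) _; rewrite ge_min lexx orbT.
have EE : 'D_w ('D_v f) (x + c *: v + d *: w) = 'D_v ('D_w f) (x + c' *: w + d' *: v).
  have hn0 : h != 0 by rewrite gt_eqF.
  apply: (mulfI hn0); apply: (mulfI hn0).
  apply: etrans (esym E) (etrans _ E'); rewrite (addrAC x (h *: w)).
  move: (f (x + h *: v + h *: w)) (f (x + h *: v)) (f (x + h *: w)) (f x) => A B C D.
  ring.
rewrite EE in B1.
by have := tri _ _ _ _ B1 B2; rewrite ee ltxx.
Qed.

End DirectionalDerivatives.

(** * Smooth functions, the Euler operator, dilations and test functions *)

Section SmoothFunctions.
Local Opaque derive.
Variables (R : realType) (n : nat).
Local Notation space := 'rV[R]_n.
Implicit Types (f g : space -> R) (x v : space) (i j : 'I_n) (s : seq 'I_n).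
Implicit Types (U : set space).

Local Notation e_ j := (delta_mx 0 j : space).

Lemma partials_rcons s j f : partials s (partial j f) = partials (rcons s j) f.
Proof. by rewrite /partials foldr_rcons. Qed.

Lemma smooth_partial j f : smooth f -> smooth (partial j f).
Proof. by move=> sf s; rewrite partials_rcons; exact: sf. Qed.

Lemma smooth_partials s f : smooth f -> smooth (partials s f).
Proof. by elim: s => [|j s IH] sf; [exact: sf | exact: smooth_partial (IH sf)]. Qed.

Lemma smooth_continuous f : smooth f -> continuous f.
Proof. by move=> sf; have [] := sf [::]. Qed.

Lemma smooth_derivable f x j : smooth f -> derivable f x (e_ j).
Proof. by move=> sf; have [_] := sf [::]; apply. Qed.

Lemma smooth_is_partial f x j : smooth f -> is_derive x (e_ j) f (partial j f x).
Proof. by move=> sf; split; [exact: smooth_derivable sf | exact: erefl]. Qed.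

Lemma partial_lin (c : R) f g j : smooth f -> smooth g ->
  partial j (fun x => c * f x + g x) = (fun x => c * partial j f x + partial j g x).
Proof.
move=> sf sg; apply/funext => x.
have := is_deriveD (is_deriveZ c (smooth_is_partial x j sf)) (smooth_is_partial x j sg).
by case.
Qed.

Lemma partials_lin (c : R) f g s : smooth f -> smooth g ->
  partials s (fun x => c * f x + g x) = (fun x => c * partials s f x + partials s g x).
Proof.
move=> sf sg; elim: s => [|j s IH] /=; first exact: erefl.
by rewrite IH (partial_lin _ _ (smooth_partials s sf) (smooth_partials s sg)).
Qed.

Lemma smooth_lin (c : R) f g : smooth f -> smooth g -> smooth (fun x => c * f x + g x).
Proof.
move=> sf sg s; rewrite (partials_lin _ _ sf sg).
have sfs := smooth_partials s sf; have sgs := smooth_partials s sg; split.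
  move=> x; apply: continuousD (@smooth_continuous _ sgs x).
  exact: continuousM (@cst_continuous _ _ c x) (@smooth_continuous _ sfs x).
move=> j x.
by have [] := is_deriveD (is_deriveZ c (smooth_is_partial x j sfs)) (smooth_is_partial x j sgs).
Qed.

Lemma partial_cst0 j : partial j (fun _ : space => 0 : R) = (fun=> 0).
Proof. by apply/funext => x; exact: derive_cst. Qed.

Lemma partials_cst0 s : partials s (fun _ : space => 0 : R) = (fun=> 0).
Proof.
by elim: s => //= j s ->; exact: partial_cst0.
Qed.

Lemma smooth0 : smooth (fun _ : space => 0 : R).
Proof.
move=> s; rewrite partials_cst0; split => [x|j x]; first exact: cst_continuous.
exact: derivable_cst.
Qed.

Lemma is_derive_coord x v j : is_derive x v (fun y : space => y 0 j) (v 0 j).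
Proof.
have E : (fun h : R => h^-1 *: (((fun y : space => y 0 j) \o shift x) (h *: v) - x 0 j)) @ 0^'
    --> v 0 j.
  apply: cvg_trans (near_eq_cvg _) (cvg_cst (v 0 j)); near=> h => /=.
  by rewrite !mxE addrK scalerA mulVf ?scale1r //; near: h; exact: nbhs_dnbhs_neq.
by split; [apply/cvg_ex; exists (v 0 j) | exact: cvg_lim E].
Unshelve. all: by end_near. Qed.

Lemma partial_coord_mul f i j x : smooth f ->
  is_derive x (e_ i) (fun y => y 0 j * f y) ((i == j)%:R * f x + x 0 j * partial i f x).
Proof.
move=> sf.
apply: (is_derive_eq (is_deriveM (is_derive_coord x (e_ i) j) (smooth_is_partial x i sf))).
by rewrite mxE eqxx addrC (eq_sym i j); congr (_ + _); exact: mulrC.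
Qed.

Lemma smooth_coord_mul f j : smooth f -> smooth (fun x => x 0 j * f x).
Proof.
move=> sf.
(* Functions x_j g + h with [g], [h] smooth are stable under partial derivatives, so every iterated
   derivative has this shape. *)
have H s : exists g h, [/\ smooth g, smooth h &
    partials s (fun x => x 0 j * f x) = (fun x => x 0 j * g x + h x)].
  elim: s => [|i s [g [h [sg sh E]]]].
    exists f, (fun=> 0); split; [exact: sf | exact: smooth0 |].
    by apply/funext => x; rewrite addr0.
  exists (partial i g), (fun x => (i == j)%:R * g x + partial i h x); split.
  - exact: smooth_partial sg.
  - exact: smooth_lin sg (smooth_partial i sh).
  rewrite /= E; apply/funext => x.
  have [_] := is_deriveD (partial_coord_mul i j x sg) (smooth_is_partial x i sh).
  by rewrite /partial => ->; rewrite addrA; congr (_ + _); rewrite addrC.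
move=> s; have [g [h [sg sh ->]]] := H s; split => [x|i x].
  apply: continuousD (@smooth_continuous _ sh x).
  exact: continuousM (@coord_continuous _ _ _ _ _ x) (@smooth_continuous _ sg x).
by have [] := is_deriveD (partial_coord_mul i j x sg) (smooth_is_partial x i sh).
Qed.

Lemma smooth_sum (I : Type) (r : seq I) (F : I -> space -> R) :
  (forall k, smooth (F k)) -> smooth (fun x => \sum_(k <- r) F k x).
Proof.
move=> sF; elim: r => [|k r IH].
  by under eq_fun do rewrite big_nil; exact: smooth0.
under eq_fun do rewrite big_cons -[F k _]mul1r.
exact: smooth_lin (sF k) IH.
Qed.

Lemma smooth_scale (c : R) f : smooth f -> smooth (fun x => c * f x).
Proof.
move=> sf; have := smooth_lin c sf smooth0.
suff -> : (fun x => c * f x + 0) = (fun x => c * f x) by [].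
by apply/funext => x; rewrite addr0.
Qed.

Lemma partial_scale (c : R) f j : smooth f ->
  partial j (fun x => c * f x) = (fun x => c * partial j f x).
Proof.
by move=> sf; apply/funext => x; have [_] := is_deriveZ c (smooth_is_partial x j sf).
Qed.

(** [smooth] concerns coordinate directions only; a general direction is assembled one coordinate at
    a time by [is_derive_addv], the derivative along the coordinates already treated being
    continuous. *)
Lemma smooth_is_derive f x v : smooth f ->
  is_derive x v f (\sum_j v 0 j * partial j f x).
Proof.
move=> sf; rewrite {1}(row_sum_delta v).
elim: (index_enum _) x => [|j r IH] x.
  by rewrite !big_nil; exact: is_derive0.
rewrite !big_cons.
have [dj ej] := is_derive_scalev (v 0 j) (@smooth_derivable f x j sf).
have IH' y := IH y; set w := \sum_(k <- r) v 0 k *: _ in IH' *.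
rewrite -ej -(@derive_val _ _ _ _ _ _ _ (IH x)); apply: is_derive_addv; first exact: dj.
  by move=> y; have [] := IH y.
have -> : 'D_w f = (fun y => \sum_(k <- r) v 0 k * partial k f y).
  by apply/funext => y; have [] := IH y.
apply: smooth_continuous; apply: smooth_sum => k.
exact: smooth_scale (smooth_partial k sf).
Qed.

Lemma partialC f i j : smooth f -> partial i (partial j f) = partial j (partial i f).
Proof.
move=> sf; apply/funext => x; apply: derive_comm => [y|y|y|y||].
- exact: smooth_derivable sf.
- exact: smooth_derivable sf.
- exact: smooth_derivable (smooth_partial j sf).
- exact: smooth_derivable (smooth_partial i sf).
- exact: (@smooth_continuous _ (smooth_partial i (smooth_partial j sf)) x).
exact: (@smooth_continuous _ (smooth_partial j (smooth_partial i sf)) x).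
Qed.

(* The Lie derivative along the Euler field of a coefficient of degree [m] in [dx]. *)
Definition euler (m : nat) f : space -> R :=
  fun x => m%:R * f x + \sum_j x 0 j * partial j f x.

Lemma smooth_euler m f : smooth f -> smooth (euler m f).
Proof.
move=> sf; apply: (smooth_lin _ sf); apply: smooth_sum => j.
exact: smooth_coord_mul (smooth_partial j sf).
Qed.

(** The commutator of d/dx_i with the Euler field is d/dx_i, so each derivative raises the weight by
    one. *)
Lemma partial_euler m f i : smooth f -> partial i (euler m f) = euler m.+1 (partial i f).
Proof.
move=> sf; apply/funext => x.
have H : is_derive x (e_ i) (euler m f) (m%:R * partial i f x +
    \sum_j ((i == j)%:R * partial j f x + x 0 j * partial i (partial j f) x)).
  apply: is_deriveD; first exact: is_deriveZ (smooth_is_partial x i sf).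
  have -> : (fun x0 : space => \sum_j x0 0 j * partial j f x0) =
      \sum_j (fun x0 : space => x0 0 j * partial j f x0).
    by apply/funext => y; rewrite fct_sumE.
  apply: is_derive_sum => j; exact: partial_coord_mul (smooth_partial j sf).
have S1 : \sum_j (i == j)%:R * partial j f x = partial i f x.
  rewrite (bigD1 i) //= eqxx mul1r big1 ?addr0 // => j.
  by rewrite eq_sym => /negPf ->; rewrite mul0r.
have S2 : \sum_j x 0 j * partial i (partial j f) x = \sum_j x 0 j * partial j (partial i f) x.
  by apply: eq_bigr => j _; rewrite (partialC i j sf).
have S : \sum_j ((i == j)%:R * partial j f x + x 0 j * partial i (partial j f) x) =
    partial i f x + \sum_j x 0 j * partial j (partial i f) x.
  by apply: etrans (big_split _ _ _ _ _) _; exact: (congr2 +%R S1 S2).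
have [_ E] := H; rewrite -[LHS]/('D_(e_ i) (euler m f) x) E S /euler -natr1.
rewrite [(_ + 1) * _]mulrDl mul1r; exact: addrA.
Qed.

Lemma partials_euler m f s : smooth f ->
  partials s (euler m f) = euler (m + size s) (partials s f).
Proof.
move=> sf; elim: s => [|j s IH] /=; first by rewrite addn0.
by rewrite IH (partial_euler _ _ (smooth_partials s sf)) addnS.
Qed.

(** What the pullback under dilation by [t] does to the coefficient of a monomial with [m] factors
    dx. *)
Definition scaled (m : nat) (t : R) f : space -> R := fun x => t ^+ m * f (t *: x).

Lemma is_partial_scaled m t f x j : smooth f ->
  is_derive x (e_ j) (scaled m t f) (scaled m.+1 t (partial j f) x).
Proof.
move=> sf; have H := derive_scale_arg (@smooth_derivable f (t *: x) j sf).
apply: (is_derive_eq (is_deriveZ (t ^+ m) H)).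
by rewrite /scaled exprSr -mulrA.
Qed.

Lemma partials_scaled m t f s : smooth f ->
  partials s (scaled m t f) = scaled (m + size s) t (partials s f).
Proof.
move=> sf; elim: s => [|j s IH] /=; first by rewrite addn0.
rewrite IH addnS; apply/funext => x.
by have [_] := is_partial_scaled (m + size s) t x j (smooth_partials s sf).
Qed.

Lemma smooth_scaled m t f : smooth f -> smooth (scaled m t f).
Proof.
move=> sf s; rewrite (partials_scaled _ _ _ sf); have sfs := smooth_partials s sf.
split => [x|j x]; last by have [] := is_partial_scaled (m + size s) t x j sfs.
apply: continuousM (@cst_continuous _ _ (t ^+ (m + size s)) x) _.
apply: (@continuous_comp _ _ _ (fun y : space => t *: y)); first exact: scaler_continuous.
exact: (smooth_continuous sfs).
Qed.

(** In the logarithmic variable the dilations form a one-parameter group, whose generator in weight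
    [m] is [euler m]. *)
Lemma is_derive_scaled_expR m f x (s : R) : smooth f ->
  is_derive s (1 : R) (fun r : R => scaled m (expR r) f x) (scaled m (expR s) (euler m f) x).
Proof.
move=> sf; have [dx ex] := smooth_is_derive (expR s *: x) x sf.
have dl : is_derive (expR s) (1 : R) (fun t : R => f (t *: x)) ('D_x f (expR s *: x)).
  have := @is_derive_line R _ f 0 x (expR s); rewrite add0r => /(_ dx).
  by under eq_fun do rewrite add0r.
have df : is_derive s (1 : R) (fun r : R => f (expR r *: x)) ('D_x f (expR s *: x) * expR s).
  exact: is_derive1_comp dl (is_derive_expR s).
have de : is_derive s (1 : R) (fun r : R => expR (m%:R * r)) (expR (m%:R * s) * m%:R).
  have dz : is_derive s (1 : R) (m%:R *: (id : R -> R)) m%:R.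
    by apply: (is_derive_eq (is_deriveZ _ (is_derive_id s (1 : R)))); exact: mulr1.
  exact: is_derive1_comp (is_derive_expR (m%:R * s)) dz.
have -> : (fun r : R => scaled m (expR r) f x) =
    (fun r : R => expR (m%:R * r)) * (fun r : R => f (expR r *: x)).
  by apply/funext => r; rewrite /scaled -expRM_natl.
apply: (is_derive_eq (is_deriveM de df)); rewrite ex /scaled /euler expRM_natl.
have -> : \sum_j (expR s *: x) 0 j * partial j f (expR s *: x) =
    (\sum_j x 0 j * partial j f (expR s *: x)) * expR s.
  by rewrite mulr_suml; apply: eq_bigr => j _; rewrite mxE -!mulrA mulrC mulrA.
move: (\sum_j _) (f _) => A B; rewrite -![_ *: _]/(_ * _); ring.
Qed.

Lemma scaled1 m f : scaled m 1 f = f.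
Proof. by apply/funext => x; rewrite /scaled expr1n mul1r scale1r. Qed.

(** Two mean values, for [f] and for [euler m f], give the factors [s] and [c] with |c| <= |s|;
    [expR 1 ^+ m] bounds the weight at times |d| <= 1. *)
Lemma scaled_taylor m f (B : R) x (s : R) : smooth f -> `|s| <= 1 ->
  (forall y, `|euler m (euler m f) y| <= B) ->
  `|scaled m (expR s) f x - f x - s * euler m f x| <= s ^+ 2 * (expR 1 ^+ m * B).
Proof.
move=> sf s1 hB; have se := smooth_euler m sf.
have mvt g t : smooth g -> exists2 c : R, `|c| <= `|t| &
    scaled m (expR t) g x - g x = t * scaled m (expR c) (euler m g) x.
  move=> sg; pose G (r : R) := scaled m (expR r) g x.
  have dG (y : R) : is_derive y (1 : R) G (scaled m (expR y) (euler m g) x).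
    exact: is_derive_scaled_expR.
  have [y|c ct E] := @derive_mean_value R R G 0 1 t; first by have [] := dG y.
  exists c; first exact: ct.
  move: E; rewrite !add0r [t *: 1]mulr1 [c *: 1]mulr1.
  by have [_ ->] := dG c; rewrite {2}/G expR0 scaled1.
have [c cs E1] := mvt f s sf; rewrite E1.
have [d dc E2] := mvt (euler m f) c se.
have s2 : s ^+ 2 = `|s| * `|s| by rewrite -expr2 real_normK // num_real.
rewrite -mulrBr E2 normrM normrM s2 -[leRHS]mulrA.
have ds : `|d| <= 1 by rewrite (le_trans dc) // (le_trans cs).
have hd : `|scaled m (expR d) (euler m (euler m f)) x| <= expR 1 ^+ m * B.
  rewrite /scaled normrM ger0_norm ?exprn_ge0 ?expR_ge0 //.
  apply: ler_pM; rewrite ?exprn_ge0 ?expR_ge0 // lerXn2r ?nnegrE ?expR_ge0 // ler_expR.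
  exact: le_trans (ler_norm _) ds.
apply: ler_pM; [exact: normr_ge0 | by rewrite mulr_ge0 ?normr_ge0 | exact: lexx |].
by apply: ler_pM; [exact: normr_ge0 | exact: normr_ge0 | exact: cs | exact: hd].
Qed.

Lemma scaledM m (t r : R) f : scaled m t (scaled m r f) = scaled m (r * t) f.
Proof. by apply/funext => x; rewrite /scaled scalerA exprMn mulrA (mulrC (t ^+ m)). Qed.

Local Notation supp f := (closure [set x : space | f x != 0]).

Lemma test_fun_smooth U f : test_fun U f -> smooth f.
Proof. by case. Qed.

Lemma supp_subset f x : f x != 0 -> supp f x.
Proof. by move=> fx; apply: subset_closure. Qed.

Lemma nsupp0 f x : ~ supp f x -> f x = 0.
Proof. by move=> nfx; apply/eqP; apply: contrapT => /negP/supp_subset. Qed.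

Lemma closure_sub_closed (A C : set space) : closed C -> A `<=` C -> closure A `<=` C.
Proof. by move=> cC AC; rewrite (iffLR (closure_id _) cC); exact: closureS. Qed.

Lemma test_fun_supp U f g : test_fun U f -> smooth g ->
  (forall x, g x != 0 -> supp f x) -> test_fun U g.
Proof.
move=> [_ cf fU] sg gf.
have gf' : supp g `<=` supp f by apply: closure_sub_closed gf; exact: closed_closure.
split; [exact: sg | | exact: subset_trans gf' fU].
apply: subclosed_compact cf gf'; exact: closed_closure.
Qed.

(** The complement of the support is open, so off the support [f] vanishes in a whole
    neighbourhood. *)
Lemma partial_supp f j x : partial j f x != 0 -> supp f x.
Proof.
move=> pf; apply: contrapT => nfx; move/eqP: pf; apply.
rewrite /partial -[RHS](derive_cst (0 : R) x (e_ j)); apply: near_eq_derive.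
have : nbhs x (~` supp f).
  by apply: open_nbhs_nbhs; split => //; apply: closed_openC; exact: closed_closure.
by apply: filterS => y nfy; exact: nsupp0.
Qed.

Lemma test_fun_partial U f j : test_fun U f -> test_fun U (partial j f).
Proof.
move=> tf; apply: (test_fun_supp tf); first exact: smooth_partial (test_fun_smooth tf).
exact: partial_supp.
Qed.

Lemma test_fun_coord_mul U f j : test_fun U f -> test_fun U (fun x => x 0 j * f x).
Proof.
move=> tf; apply: (test_fun_supp tf); first exact: smooth_coord_mul (test_fun_smooth tf).
by move=> x; rewrite mulf_eq0 negb_or => /andP[_]; exact: supp_subset.
Qed.

Lemma test_fun0 U : test_fun U (fun _ : space => 0 : R).
Proof.
have E : [set x : space | (0 : R) != 0] = set0.
  by apply/seteqP; split => x //=; rewrite eqxx.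
split; [exact: smooth0 | rewrite E closure0; exact: compact0 | rewrite E closure0 //].
Qed.

Lemma test_fun_lin U (c : R) f g :
  test_fun U f -> test_fun U g -> test_fun U (fun x => c * f x + g x).
Proof.
move=> [sf cf fU] [sg cg gU].
have S : supp (fun x => c * f x + g x) `<=` supp f `|` supp g.
  rewrite -closureU; apply: closureS => x /=; apply: contra_neqP.
  by move=> /not_orP[/negP/negPn/eqP -> /negP/negPn/eqP ->]; rewrite mulr0 addr0.
split; first exact: smooth_lin.
  apply: subclosed_compact S; [exact: closed_closure | exact: compactU].
by move=> x /S[/fU|/gU].
Qed.

Lemma test_fun_sum U (I : Type) (r : seq I) (F : I -> space -> R) :
  (forall k, test_fun U (F k)) -> test_fun U (fun x => \sum_(k <- r) F k x).
Proof.
move=> sF; elim: r => [|k r IH].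
  suff -> : (fun x => \sum_(k <- [::]) F k x) = (fun=> 0) by exact: test_fun0.
  by apply/funext => x; rewrite big_nil.
have -> : (fun x => \sum_(l <- k :: r) F l x) = (fun x => 1 * F k x + \sum_(l <- r) F l x).
  by apply/funext => x; rewrite big_cons mul1r.
exact: test_fun_lin (sF k) IH.
Qed.

Lemma test_fun_scale U (c : R) f : test_fun U f -> test_fun U (fun x => c * f x).
Proof.
move=> tf; have := test_fun_lin c tf (test_fun0 U).
suff -> : (fun x => c * f x + 0) = (fun x => c * f x) by [].
by apply/funext => x; rewrite addr0.
Qed.

Lemma test_fun_euler U m f : test_fun U f -> test_fun U (euler m f).
Proof.
move=> tf; apply: (test_fun_lin _ tf); apply: test_fun_sum => j.
exact: (test_fun_coord_mul j (test_fun_partial j tf)).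
Qed.

Lemma test_fun_bounded U f : test_fun U f -> exists B, forall x, `|f x| <= B.
Proof.
move=> [sf cf fU].
have : compact (f @` supp f).
  apply: continuous_compact cf; apply: continuous_subspaceT; exact: smooth_continuous.
move=> /compact_bounded[M [Mr HM]].
exists (`|M| + 1) => x.
have [fx0|/eqP fx0] := eqVneq (f x) 0; first by rewrite fx0 normr0 addr_ge0.
apply: (HM (`|M| + 1)); first by rewrite (le_lt_trans (ler_norm _)) // ltrDl.
by exists x => //; apply: supp_subset; apply/eqP.
Qed.

Lemma test_fun_partials_bounded U f N : test_fun U f ->
  exists B, forall s x, (size s <= N)%N -> `|partials s f x| <= B.
Proof.
elim: N f => [|N IH] f tf; have [B0 h0] := test_fun_bounded tf.
  by exists B0 => -[|//] x _; exact: h0.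
have /choice[B hB] := fun j => IH _ (test_fun_partial j tf).
have B0_ge0 : 0 <= B0 by exact: le_trans (normr_ge0 _) (h0 0).
have B_ge0 j : 0 <= B j by exact: le_trans (normr_ge0 _) (hB j [::] 0 isT).
(* Splitting off the last entry, i.e. the derivative applied first, leaves at most [N] derivatives
   of the test function [partial j f]. *)
exists (B0 + \sum_j B j) => s x; case/lastP: s => [|s j] hs.
  by rewrite (le_trans (h0 x)) // lerDl sumr_ge0.
rewrite -partials_rcons (le_trans (hB j s x _)) //; first by rewrite size_rcons in hs.
by rewrite (bigD1 j) //= addrCA lerDl addr_ge0 // sumr_ge0.
Qed.

Lemma scaled_supp m (t : R) f x : t != 0 -> scaled m t f x != 0 -> supp f (t *: x).
Proof.
move=> t0; rewrite /scaled mulf_eq0 negb_or => /andP[_]; exact: supp_subset.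
Qed.

Lemma test_fun_scaled m (t : R) f : t != 0 ->
  test_fun (@punctured R n) f -> test_fun (@punctured R n) (scaled m t f).
Proof.
move=> t0 [sf cf fU]; pose K := ( *:%R t^-1 : space -> space) @` supp f.
have cK : compact K.
  by apply: continuous_compact cf; apply: continuous_subspaceT; exact: scaler_continuous.
have S : supp (scaled m t f) `<=` K.
  apply: closure_sub_closed; first by apply: compact_closed cK; exact: norm_hausdorff.
  move=> x /(scaled_supp t0) fx; exists (t *: x) => //=.
  by rewrite scalerA mulVf // scale1r.
split; first exact: smooth_scaled.
  by apply: subclosed_compact cK S; exact: closed_closure.
move=> x /S[y fy <-] /= /eqP; rewrite scaler_eq0 invr_eq0 (negPf t0) /=.
by move/eqP; exact: fU.
Qed.

(** Continuity constants of a current belong to one compact set, so the supports of all dilates with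
    |s| <= 1 must fit into a single one off the origin. *)
Lemma scaled_compact f : test_fun (@punctured R n) f ->
  exists K : set space, [/\ compact K, K `<=` @punctured R n, supp f `<=` K &
    forall (s : R) x, `|s| <= 1 -> supp f (expR s *: x) -> K x].
Proof.
move=> [sf cf fU].
(* The compact set is the image of [exp (-1), exp 1] x supp f under scalar multiplication; the
   factors are nonzero, so it avoids the origin. *)
pose P : set R := expR @` `[-1, 1]%classic.
pose K : set space := (fun p : R * space => p.1 *: p.2) @` (P `*` supp f).
have cP : compact P.
  by apply: continuous_compact (@segment_compact _ _ _); apply: continuous_subspaceT;
    exact: continuous_expR.
exists K; split.
- apply: continuous_compact (compact_setX cP cf); apply: continuous_subspaceT.
  exact: scale_continuous.
- move=> _ [[r y] [/= [u _ <-] fy] <-] /= /eqP; rewrite scaler_eq0 expR_eq0 /=.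
  by move/eqP; exact: fU.
- move=> x fx; exists (1, x); last by rewrite /= scale1r.
  by split => //=; exists 0; rewrite ?expR0 //= in_itv /= lerN10 ler01.
move=> s x s1 fx; exists (expR (- s), expR s *: x); last first.
  by rewrite /= scalerA -expRD addNr expR0 scale1r.
by split => //=; exists (- s) => //=; rewrite in_itv /= -ler_norml normrN.
Qed.

End SmoothFunctions.

(** * Superforms and currents *)

Section CoefficientwiseOperators.
Variables (R : realType) (n : nat).
Local Notation space := 'rV[R]_n.
Local Notation ext := (extalg R n).
Implicit Types (al be : superform R n) (U : set space).

Local Opaque derive.

Definition smooth_form al := forall I K, smooth (coef al I K).

Lemma test_form_smooth U p q al : test_form U p q al -> smooth_form al.
Proof. by move=> [_ tal] I K; have [] := tal I K. Qed.

(* Contractions and [wedge (dx R j)] only permute and rescale the coefficients. *)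
Definition coefwise (T : ext -> ext) := forall I K : {set 'I_n},
  exists (c : R) (I' K' : {set 'I_n}), forall w, T w (I, K) = c * w (I', K') :> R.

Lemma coefwise_contr_dxi j : coefwise (@contr_dxi R n j).
Proof.
move=> I K; case: (boolP (j \in K)) => jK.
  by exists 0, I, K => w; rewrite contr_dxiE jK mul0r.
exists ((-1) ^+ #|I| * sg R j K), I, (j |: K) => w.
by rewrite contr_dxiE (negPf jK).
Qed.

Lemma coefwise_contr_dx j : coefwise (@contr_dx R n j).
Proof.
move=> I K; case: (boolP (j \in I)) => jI.
  by exists 0, I, K => w; rewrite contr_dxE jI mul0r.
exists (sg R j I), (j |: I), K => w.
by rewrite contr_dxE (negPf jI).
Qed.

Lemma coefwise_wedge_dx j : coefwise (wedge (dx R j) : ext -> ext).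
Proof.
move=> I K; case: (boolP (j \in I)) => jI; last first.
  by exists 0, I, K => w; rewrite wedge_dxE (negPf jI) mul0r.
exists (sg R j (I :\ j)), (I :\ j)%SET, K => w.
by rewrite wedge_dxE jI.
Qed.

Lemma coefwise_swap : coefwise (@swap R n).
Proof. by move=> I K; exists 1, K, I => w; rewrite swapE mul1r. Qed.

Definition pder j al : superform R n :=
  fun x => [ffun J : {set 'I_n} * {set 'I_n} => partial j (coef al J.1 J.2) x].

Lemma pderE j al x I K : pder j al x (I, K) = partial j (coef al I K) x :> R.
Proof. by rewrite ffunE. Qed.

Lemma coef_pder j al I K : coef (pder j al) I K = partial j (coef al I K).
Proof. by apply/funext => x; rewrite /coef pderE. Qed.

Lemma coef_coefwise T al I K : coefwise T -> exists (c : R) I' K',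
  coef (fun x => T (al x)) I K = (fun x => c * coef al I' K' x).
Proof.
move=> /(_ I K)[c [I' [K' E]]]; exists c, I', K'.
by apply/funext => x; rewrite /coef E.
Qed.

Lemma smooth_coefwise T al : coefwise T -> smooth_form al ->
  smooth_form (fun x => T (al x)).
Proof.
move=> cT sal I K; have [c [I' [K' ->]]] := coef_coefwise al I K cT.
exact: smooth_scale (sal I' K').
Qed.

Lemma pder_coefwise T al j x : coefwise T -> smooth_form al ->
  pder j (fun x => T (al x)) x = T (pder j al x).
Proof.
move=> cT sal; apply: extP => I K; rewrite pderE.
have [c [I' [K' E]]] := cT I K; rewrite E pderE.
have -> : coef (fun x => T (al x)) I K = (fun x => c * coef al I' K' x).
  by apply/funext => y; rewrite /coef E.
by rewrite (partial_scale c j (sal I' K')).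
Qed.

Lemma test_fun_coefwise U T al I K : coefwise T ->
  (forall I K, test_fun U (coef al I K)) -> test_fun U (coef (fun x => T (al x)) I K).
Proof.
move=> cT tal; have [c [I' [K' ->]]] := coef_coefwise al I K cT.
exact: test_fun_scale.
Qed.

(** Covers both [delta_sharp] (with [contr_dxi]) and contraction with the Euler field (with
    [contr_dx]), so that they share one product rule. *)
Definition euler_contr (T : 'I_n -> ext -> ext) al : superform R n :=
  fun x => \sum_j x 0 j *: T j (al x).

Lemma coef_euler_contr T al I K : coef (euler_contr T al) I K =
  (fun x => \sum_j x 0 j * coef (fun x => T j (al x)) I K x).
Proof.
by apply/funext => x; rewrite /coef /euler_contr sum_ffunE; apply: eq_bigr => j _; rewrite extZ.
Qed.

Lemma pder_euler_contr T al j x : (forall k, coefwise (T k)) -> smooth_form al ->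
  pder j (euler_contr T al) x = T j (al x) + \sum_k x 0 k *: T k (pder j al x).
Proof.
move=> cT sal; apply: extP => I K; rewrite pderE coef_euler_contr extD sum_ffunE.
have sT k : smooth (coef (fun x => T k (al x)) I K) by exact: smooth_coefwise.
have H : is_derive x (delta_mx 0 j : space)
    (fun x => \sum_k x 0 k * coef (fun x => T k (al x)) I K x)
    (\sum_k ((j == k)%:R * coef (fun x => T k (al x)) I K x +
      x 0 k * partial j (coef (fun x => T k (al x)) I K) x)).
  have -> : (fun x0 : space => \sum_k x0 0 k * coef (fun x => T k (al x)) I K x0) =
      \sum_k (fun x0 : space => x0 0 k * coef (fun x => T k (al x)) I K x0).
    by apply/funext => y; rewrite fct_sumE.
  by apply: is_derive_sum => k; exact: partial_coord_mul.
have [_ E] := H; apply: etrans E _.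
apply: etrans (big_split _ _ _ _ _) _; apply: (congr2 +%R).
  rewrite (bigD1 j) //= eqxx mul1r big1 ?addr0 // => k.
  by rewrite eq_sym => /negPf ->; rewrite mul0r.
apply: eq_bigr => k _; rewrite extZ; congr (_ * _).
by rewrite -(pder_coefwise j x (cT k) sal) pderE.
Qed.

Lemma superdE al x : superd al x = \sum_j wedge (dx R j) (pder j al x).
Proof. by []. Qed.

Lemma coef_superd al I K : coef (superd al) I K =
  (fun x => \sum_j coef (fun x => wedge (dx R j) (pder j al x)) I K x).
Proof. by apply/funext => x; rewrite /coef sum_ffunE. Qed.

Lemma delta_sharpE al : delta_sharp al = euler_contr (@contr_dxi R n) al.
Proof. by []. Qed.

(** Differentiating the factors x_j produces [ext_J]; the terms with derivatives of coefficients
    cancel because [contr_dxi] anticommutes with every dx_j. *)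
Lemma superd_delta_sharp al x : smooth_form al ->
  superd (delta_sharp al) x + delta_sharp (superd al) x = ext_J (al x).
Proof.
move=> sal; rewrite /ext_J superdE delta_sharpE.
under eq_bigr do rewrite (pder_euler_contr _ _ (@coefwise_contr_dxi) sal) wedgeDr wedge_sumr.
rewrite big_split /= -addrA exchange_big /= /delta_sharp -big_split.
rewrite [X in _ + X]big1 ?addr0 // => k _ /=.
rewrite superdE contr_dxi_sum scaler_sumr -big_split big1 // => j _ /=.
by rewrite wedgeZr contr_dxi_wedge_dx scalerN subrr.
Qed.

(** Lie derivative along the Euler field: dx_j has weight one and dxi_j weight zero. *)
Definition lie al : superform R n :=
  fun x => [ffun J : {set 'I_n} * {set 'I_n} => euler #|J.1| (coef al J.1 J.2) x].

Lemma coef_lie al I K : coef (lie al) I K = euler #|I| (coef al I K).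
Proof. by apply/funext => x; rewrite /coef ffunE. Qed.

(** Cartan's formula: differentiating the factors x_j counts the dx's, and of the other terms only
    the diagonal ones survive the Clifford relation. *)
Lemma superd_contr_dx al x : smooth_form al ->
  superd (euler_contr (@contr_dx R n) al) x + euler_contr (@contr_dx R n) (superd al) x = lie al x.
Proof.
move=> sal; rewrite superdE.
under eq_bigr do rewrite (pder_euler_contr _ _ (@coefwise_contr_dx) sal) wedgeDr wedge_sumr.
rewrite big_split /= -addrA exchange_big /= /euler_contr -big_split /=.
apply: extP => I K; rewrite extD sum_wedge_dx_contr ffunE /euler /=; congr (_ + _).
rewrite sum_ffunE; apply: eq_bigr => k _; rewrite superdE contr_dx_sum scaler_sumr.
rewrite -big_split (bigD1 k) //= big1 ?addr0 => [|j jk].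
  by rewrite wedgeZr contr_dx_wedge_dx eqxx scale1r scalerBr addrC subrK extZ pderE.
by rewrite wedgeZr contr_dx_wedge_dx (negPf jk) scale0r sub0r scalerN subrr.
Qed.

Lemma test_form_contr_dxi U p q al : test_form U p q.+1 al -> test_form U p q (delta_sharp al).
Proof.
move=> [bal tal]; split => [x|I K].
  by apply: bideg_sum => j _; apply: bidegZ; exact: bideg_contr_dxi (bal x).
rewrite delta_sharpE coef_euler_contr; apply: test_fun_sum => j.
apply: (test_fun_coord_mul j); apply: test_fun_coefwise tal; exact: coefwise_contr_dxi.
Qed.

Lemma test_form_contr_dx U p q al :
  test_form U p.+1 q al -> test_form U p q (euler_contr (@contr_dx R n) al).
Proof.
move=> [bal tal]; split => [x|I K].
  by apply: bideg_sum => j _; apply: bidegZ; exact: bideg_contr_dx (bal x).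
rewrite coef_euler_contr; apply: test_fun_sum => j.
apply: (test_fun_coord_mul j); apply: test_fun_coefwise tal; exact: coefwise_contr_dx.
Qed.

Lemma bideg_pder p q al j x : (forall x, bideg p q (al x)) -> bideg p q (pder j al x).
Proof.
move=> bal I K h; rewrite pderE.
have -> : coef al I K = (fun=> 0) by apply/funext => y; rewrite /coef bal.
by rewrite partial_cst0.
Qed.

Lemma test_form_superd U p q al : test_form U p q al -> test_form U p.+1 q (superd al).
Proof.
move=> [bal tal]; split => [x|I K].
  rewrite superdE; apply: bideg_sum => j _; rewrite -add1n -[q]add0n.
  by apply: bideg_wedge; [exact: bideg_dx | exact: bideg_pder].
rewrite coef_superd; apply: test_fun_sum => j.
apply: (test_fun_coefwise (al := pder j al)) => [|I' K']; first exact: coefwise_wedge_dx.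
by rewrite coef_pder; exact: test_fun_partial.
Qed.

Lemma test_form_swap U p q al : test_form U p q al -> test_form U q p (fun x => swap (al x)).
Proof.
move=> [bal tal]; split => [x|I K]; first exact: bideg_swap.
exact: test_fun_coefwise coefwise_swap tal.
Qed.

Lemma test_form_lin U p q (c : R) al be : test_form U p q al -> test_form U p q be ->
  test_form U p q (fun x => c *: al x + be x).
Proof.
move=> [bal tal] [bbe tbe]; split => [x|I K].
  by apply: bidegD; [apply: bidegZ; exact: bal | exact: bbe].
have -> : coef (fun x => c *: al x + be x) I K = (fun x => c * coef al I K x + coef be I K x).
  by apply/funext => x; rewrite /coef extD extZ.
exact: test_fun_lin.
Qed.

Lemma test_form0 U p q : test_form U p q (fun=> 0 : ext).
Proof.
split => [x|I K]; first exact: bideg0.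
have -> : coef (fun _ : space => 0 : ext) I K = (fun=> 0).
  by apply/funext => x; rewrite /coef ext0.
exact: test_fun0.
Qed.

Lemma test_form_lie U p q al : test_form U p q al -> test_form U p q (lie al).
Proof.
move=> [bal tal]; split => [x I K h|I K]; last by rewrite coef_lie; exact: test_fun_euler.
rewrite -[LHS]/(coef (lie al) I K x) coef_lie /euler.
have E0 : coef al I K = (fun=> 0) by apply/funext => y; rewrite /coef bal.
rewrite E0 mulr0 add0r big1 // => j _.
by rewrite partial_cst0 mulr0.
Qed.

Lemma coef_scale_pullback (t : R) al I K :
  coef (scale_pullback t al) I K = scaled #|I| t (coef al I K).
Proof. by apply/funext => x; rewrite /coef ffunE. Qed.

Lemma test_form_scale_pullback (t : R) p q al : t != 0 ->
  test_form (@punctured R n) p q al ->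
  test_form (@punctured R n) p q (scale_pullback t al).
Proof.
move=> t0 [bal tal]; split => [x I K h|I K].
  by rewrite -[LHS]/(coef (scale_pullback t al) I K x) coef_scale_pullback /scaled /coef bal ?mulr0.
by rewrite coef_scale_pullback; exact: test_fun_scaled.
Qed.

Lemma superform_ext al be : (forall I K, coef al I K = coef be I K) -> al = be.
Proof.
by move=> E; apply/funext => x; apply: extP => I K; exact: (congr1 (@^~ x) (E I K)).
Qed.

Lemma scale_pullbackM (t r : R) al :
  scale_pullback t (scale_pullback r al) = scale_pullback (r * t) al.
Proof. by apply: superform_ext => I K; rewrite !coef_scale_pullback scaledM. Qed.

Lemma scale_pullback1 al : scale_pullback 1 al = al.
Proof. by apply: superform_ext => I K; rewrite coef_scale_pullback scaled1. Qed.

Lemma test_form_partials_bounded U p q al N : test_form U p q al ->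
  exists B, forall I K s x, (size s <= N)%N -> `|partials s (coef al I K) x| <= B.
Proof.
move=> [_ tal].
have /choice[B hB] : forall J : {set 'I_n} * {set 'I_n}, exists B, forall s x,
    (size s <= N)%N -> `|partials s (coef al J.1 J.2) x| <= B.
  by move=> J; exact: test_fun_partials_bounded (tal J.1 J.2).
have B_ge0 J : 0 <= B J by exact: le_trans (normr_ge0 _) (hB J [::] 0 isT).
exists (\sum_J B J) => I K s x hs; apply: le_trans (hB (I, K) s x hs) _.
by rewrite (bigD1 (I, K)) //= lerDl sumr_ge0.
Qed.

(** The union over the finitely many coefficients of the compact sets from [scaled_compact]. *)
Lemma scale_pullback_compact p q al : test_form (@punctured R n) p q al ->
  exists C : set space, [/\ compact C, C `<=` @punctured R n &
    forall (s : R) x, `|s| <= 1 -> ~ C x ->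
      [/\ al x = 0, lie al x = 0 & scale_pullback (expR s) al x = 0]].
Proof.
move=> [_ tal].
have /choice[F hF] := fun J : {set 'I_n} * {set 'I_n} => scaled_compact (tal J.1 J.2).
pose C := \big[setU/set0]_J F J.
have FC J : F J `<=` C by move=> x Fx; rewrite /C (bigD1 J) //; left.
exists C; split.
- rewrite /C; elim/big_ind: _ => [|A B|J _]; [exact: compact0 | exact: compactU |].
  by have [] := hF J.
- rewrite /C; elim/big_ind: _ => [|A B hA hB x [/hA|/hB]|J _] //; by have [] := hF J.
move=> s x s1 nCx.
have nF I K : ~ F (I, K) x by move=> Fx; apply: nCx; exact: FC Fx.
split; apply: extP => I K; rewrite ext0; apply/eqP; apply: contrapT => /negP h;
  apply: (nF I K); have [_ _ sF eF] := hF (I, K).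
- by apply: sF; exact: supp_subset.
- apply: sF; apply: contrapT => nfx; move/negP: h; apply; apply/eqP.
  rewrite -[LHS]/(coef (lie al) I K x) coef_lie /euler (nsupp0 nfx) mulr0 add0r.
  rewrite big1 // => j _; rewrite [partial j _ x](_ : _ = 0) ?mulr0 //.
  by apply/eqP; apply: contrapT => /negP/partial_supp.
apply: (eF s x s1); move: h; rewrite -[X in X != 0]/(coef (scale_pullback (expR s) al) I K x).
rewrite coef_scale_pullback; apply: scaled_supp; by rewrite expR_eq0.
Qed.

End CoefficientwiseOperators.

(** * Vanishing on images of [ext_J], symmetry and invariance under dilations *)

Section StronglyHomogeneous.
Variables (R : realType) (n p : nat) (Om : functional R n).
Hypotheses (hp : (p <= n)%N) (hOm : strongly_homogeneous p Om).
Local Notation space := 'rV[R]_n.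
Local Notation ext := (extalg R n).
Local Notation U := (@punctured R n).
Implicit Types (al be : superform R n).

Let pq : (p + (n - p) = n)%N. Proof. exact: subnKC. Qed.

Lemma current_lin (c : R) al be : test_form U (n - p) (n - p) al ->
  test_form U (n - p) (n - p) be -> Om (fun x => c *: al x + be x) = c * Om al + Om be.
Proof. by have [[lOm _] _ _ _] := hOm; exact: lOm. Qed.

Lemma current0 : Om (fun=> 0) = 0.
Proof.
have t0 := @test_form0 R n U (n - p) (n - p).
have := current_lin 1 t0 t0; rewrite mul1r.
have -> : (fun x : space => 1 *: (0 : ext) + 0) = (fun=> 0).
  by apply/funext => x; rewrite scaler0 addr0.
by move=> /eqP; rewrite -subr_eq0 opprD addrA subrr sub0r oppr_eq0 => /eqP.
Qed.

Lemma currentD al be : test_form U (n - p) (n - p) al ->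
  test_form U (n - p) (n - p) be -> Om (fun x => al x + be x) = Om al + Om be.
Proof.
move=> tal tbe; rewrite -[Om al]mul1r -current_lin //; congr Om.
by apply/funext => x; rewrite scale1r.
Qed.

Lemma currentZ (c : R) al : test_form U (n - p) (n - p) al ->
  Om (fun x => c *: al x) = c * Om al.
Proof.
move=> tal; have := current_lin c tal (test_form0 _ _ _); rewrite current0 addr0 => <-.
by congr Om; apply/funext => x; rewrite addr0.
Qed.

Lemma current_superd q' al : (n - p = q'.+1)%N -> test_form U q' (n - p) al ->
  Om (superd al) = 0.
Proof.
move=> q1 tal; have [_ _ cOm _] := hOm.
have pn : (p < n)%N by rewrite -subn_gt0 q1.
have q2 : (n - p.+1 = q')%N by rewrite subnS q1.
have := cOm pn al; rewrite q2 => /(_ tal) /eqP.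
by rewrite /current_d mulf_eq0 signr_eq0 /= => /eqP.
Qed.

Lemma current_delta_sharp0 al : test_form U (n - p) (n - p).+1 al ->
  Om (delta_sharp al) = 0.
Proof.
have [_ _ _ dOm] := hOm; move=> /dOm /eqP.
by rewrite /current_delta_sharp mulf_eq0 signr_eq0 /= => /eqP.
Qed.

(** Here [ext_J (be x)] is [superd] of a (q', q'+1)-form plus [delta_sharp] of a (q'+1, q'+2)-form,
    exactly the bidegrees in which the two closedness hypotheses apply. *)
Lemma current_ext_J q' be : (n - p = q'.+1)%N -> test_form U q' q'.+2 be ->
  Om (fun x => ext_J (be x)) = 0.
Proof.
move=> q1 tbe.
have -> : (fun x => ext_J (be x)) =
    (fun x => superd (delta_sharp be) x + delta_sharp (superd be) x).
  by apply/funext => x; rewrite superd_delta_sharp //; exact: test_form_smooth tbe.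
have t1 : test_form U q' (n - p) (delta_sharp be).
  by rewrite q1; exact: test_form_contr_dxi.
have t2 : test_form U (n - p) (n - p).+1 (superd be).
  by rewrite q1; exact: test_form_superd.
have t3 := test_form_contr_dxi t2; have t4 := test_form_superd t1.
rewrite -q1 in t4; rewrite (currentD t4 t3) (current_superd q1 t1).
by rewrite (current_delta_sharp0 t2) addr0.
Qed.

Lemma current_annihilated al : test_form U (n - p) (n - p) al ->
  (forall x (a : 'I_p -> 'rV[R]_n), wedge (al x) (elementary a) = 0) -> Om al = 0.
Proof.
move=> tal hal; have [b [hb hw]] := @ext_J_section R n p (n - p) pq.
pose be : superform R n := fun x => \sum_L (al x L : R) *: b L.
have -> : al = (fun x => ext_J (be x)).
  by apply/funext => x; apply: hw; [exact: tal.1 | exact: hal].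
(* For p = n the primitive is zero by [ext_J_dom], hence so is [al]; closedness is available only
   for p < n. *)
case: (posnP (n - p)) => [q0|]; last case q1 : (n - p)%N => [//|q'] _.
  rewrite -current0; congr Om; apply/funext => x; rewrite /be big1 ?ext_J0 // => L _.
  by have := hb L; rewrite q0 /= => ->; rewrite scaler0.
apply: (current_ext_J q1); split => [x|I K].
  by apply: bideg_sum => L _; apply: bidegZ; have := hb L; rewrite q1.
have -> : coef be I K = (fun x => \sum_L b L (I, K) * coef al L.1 L.2 x).
  apply/funext => x; rewrite /coef sum_ffunE; apply: eq_bigr => -[A B] _.
  by rewrite extZ mulrC.
by apply: test_fun_sum => L; apply: test_fun_scale; exact: tal.2.
Qed.

(** The form [swap al - al] is antisymmetric at each point, so its products with elementary forms
    vanish. *)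
Lemma current_swap al : test_form U (n - p) (n - p) al ->
  Om (fun x => swap (al x)) = Om al.
Proof.
move=> tal; have tsw := test_form_swap tal.
have : Om (fun x => (-1) *: al x + swap (al x)) = 0.
  apply: current_annihilated => [|x a]; first exact: test_form_lin.
  apply: (wedge_antisym_elementary _ pq).
    by apply: bidegD; [apply: bidegZ; exact: tal.1 | exact: tsw.1].
  apply: extP => I K; rewrite swapE extN !extD !extZ !swapE; ring.
by rewrite current_lin // mulN1r => /eqP; rewrite addrC subr_eq0 => /eqP.
Qed.

(** Up to sign this contraction is [delta_sharp] conjugated by [swap], under which the current is
    invariant. *)
Lemma current_contr_dx al : test_form U (n - p).+1 (n - p) al ->
  Om (euler_contr (@contr_dx R n) al) = 0.
Proof.
move=> tal; have ts := test_form_swap tal; have td := test_form_contr_dxi ts.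
have := current_delta_sharp0 ts; rewrite -(current_swap td).
have -> : (fun x => swap (delta_sharp (fun y => swap (al y)) x)) =
    (fun x => ((-1) ^+ (n - p) : R) *: euler_contr (@contr_dx R n) al x).
  apply/funext => x; apply: extP => I K; rewrite swapE extZ !sum_ffunE mulr_sumr.
  apply: eq_bigr => j _.
  by rewrite !extZ (contr_dxi_swap j (tal.1 x)) extZ swapE mulrCA.
rewrite currentZ; last exact: test_form_contr_dx.
by move/eqP; rewrite mulf_eq0 signr_eq0 /= => /eqP.
Qed.

Lemma current_lie al : test_form U (n - p) (n - p) al -> Om (lie al) = 0.
Proof.
move=> tal; have sal := test_form_smooth tal.
have -> : lie al = (fun x => superd (euler_contr (@contr_dx R n) al) x +
    euler_contr (@contr_dx R n) (superd al) x).
  by apply/funext => x; rewrite superd_contr_dx.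
have t2 := test_form_superd tal.
(* For p = n a (0, 0)-form has no dx to contract, so only the contraction of [superd al] remains. *)
case: (posnP (n - p)) => [q0|]; last case q1 : (n - p)%N => [//|q'] _.
  have E0 : euler_contr (@contr_dx R n) al = (fun=> 0).
    apply/funext => x; rewrite /euler_contr big1 // => j _.
    rewrite [contr_dx j _](_ : _ = 0) ?scaler0 //; apply: extP => I K.
    rewrite contr_dxE ext0; case: ifP => // jI.
    by rewrite tal.1 ?mulr0 // q0 cardsU1 jI.
  have -> : (fun x => superd (euler_contr (@contr_dx R n) al) x +
      euler_contr (@contr_dx R n) (superd al) x) = euler_contr (@contr_dx R n) (superd al).
    apply/funext => x; rewrite E0 [superd _ x](_ : _ = 0) ?add0r //.
    rewrite superdE big1 // => j _; rewrite [pder j _ x](_ : _ = 0) ?wedge0r //.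
    apply: extP => I K; rewrite pderE ext0.
    have -> : coef (fun _ : space => 0 : ext) I K = (fun=> 0).
      by apply/funext => y; rewrite /coef ext0.
    by rewrite partial_cst0.
  exact: current_contr_dx t2.
have t1 : test_form U q' (n - p) (euler_contr (@contr_dx R n) al).
  by apply: test_form_contr_dx; rewrite -q1.
have t3 := test_form_contr_dx t2; have t4 := test_form_superd t1.
rewrite -q1 in t4; rewrite (currentD t4 t3) (current_superd q1 t1).
by rewrite (current_contr_dx t2) addr0.
Qed.

Lemma current_scale_taylor al : test_form U (n - p) (n - p) al ->
  exists B : R, forall s : R, `|s| <= 1 ->
    `|Om (scale_pullback (expR s) al) - Om al| <= B * s ^+ 2.
Proof.
move=> tal; have [[_ contOm] _ _ _] := hOm.
have [C [cC CU hC]] := scale_pullback_compact tal.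
have [c [N hc]] := contOm C cC CU.
have [B hB] := test_form_partials_bounded N (test_form_lie (test_form_lie tal)).
(* A coefficient with at most [n] factors dx, differentiated at most [N] times, has weight at most
   [n + N]. *)
pose M := expR 1 ^+ (n + N) * `|B|.
exists (c * M) => s s1.
have tF : test_form U (n - p) (n - p) (scale_pullback (expR s) al).
  by apply: test_form_scale_pullback tal; rewrite expR_eq0.
have tL := test_form_lie tal.
(* This is the first-order Taylor remainder of the pullback; as the current vanishes on [lie al],
   its value here is the difference to be estimated. *)
have tr := test_form_lin (-1) tal (test_form_lin (- s) tL tF).
set r := (fun x => _ + _) in tr.
have Er : Om r = Om (scale_pullback (expR s) al) - Om al.
  rewrite /r current_lin //; last exact: test_form_lin.
  by rewrite current_lin // (current_lie tal) mulr0 add0r mulN1r addrC.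
rewrite -Er -mulrA [M * _]mulrC; apply: (hc _ tr) => [x nCx|I K S x hS].
  have [e1 e2 e3] := hC s x s1 nCx.
  by rewrite /r e1 e2 e3 !scaler0 !addr0.
have sal := test_form_smooth tal I K.
have -> : coef r I K = (fun x => (-1) * coef al I K x + ((- s) * euler #|I| (coef al I K) x
    + scaled #|I| (expR s) (coef al I K) x)).
  apply/funext => y; rewrite -coef_lie -coef_scale_pullback /coef /r.
  by rewrite extD extZ extD extZ.
have se := smooth_euler #|I| sal; have ss := smooth_scaled #|I| (expR s) sal.
rewrite (partials_lin _ _ sal (smooth_lin _ se ss)) (partials_lin _ _ se ss).
rewrite (partials_scaled _ _ _ sal) (partials_euler _ _ sal).
set m := (#|I| + size S)%N; set g := partials S _.
have hb y : `|euler m (euler m g) y| <= B.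
  rewrite -partials_euler // -partials_euler //; first rewrite -!coef_lie; exact: hB.
have := scaled_taylor x (smooth_partials S sal) s1 hb.
rewrite -/g -addrA mulN1r mulNr => /le_trans hx.
have -> : - g x + (- (s * euler m g x) + scaled m (expR s) g x) =
    scaled m (expR s) g x + (- g x - s * euler m g x).
  by rewrite addrA addrC.
apply: hx; rewrite ler_wpM2l ?sqr_ge0 // /M.
have m_le : (m <= n + N)%N by rewrite leq_add // -[leqRHS]card_ord max_card.
apply: (@le_trans _ _ (expR 1 ^+ m * `|B|)).
  by rewrite ler_wpM2l ?exprn_ge0 ?expR_ge0 // ler_norm.
rewrite ler_wpM2r // ler_weXn2l //.
by rewrite -expR0 ler_expR.
Qed.

(** The group law moves the quadratic estimate from time 0 to any time [r], so [psi] has zero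
    derivative everywhere. *)
Lemma current_scale_expR al (s : R) : test_form U (n - p) (n - p) al ->
  Om (scale_pullback (expR s) al) = Om al.
Proof.
move=> tal; pose psi (r : R) := Om (scale_pullback (expR r) al).
suff -> : Om (scale_pullback (expR s) al) = psi 0.
  by rewrite /psi expR0 scale_pullback1.
apply: (@is_derive_0_is_cst _ psi) => r.
have tr : test_form U (n - p) (n - p) (scale_pullback (expR r) al).
  by apply: test_form_scale_pullback tal; rewrite expR_eq0.
have [B hB] := current_scale_taylor tr.
have psiD (h : R) : psi (h + r) = Om (scale_pullback (expR h) (scale_pullback (expR r) al)).
  by rewrite /psi scale_pullbackM addrC expRD.
suff H : h^-1 *: ((psi \o shift r) (h *: (1 : R)) - psi r) @[h --> 0^'] --> (0 : R).
  by split; [apply/cvg_ex; exists 0 | exact: cvg_lim H].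
apply: norm_cvg0.
apply: (@squeeze_cvgr _ _ _ _ (cst 0) (fun h : R => `|B| * `|h|)).
- near=> h; rewrite normr_ge0 /= [h *: 1]mulr1 psiD.
  have h0 : h != 0 by near: h; exact: nbhs_dnbhs_neq.
  have h1 : `|h| <= 1.
    by near: h; apply: nbhs_dnbhs; apply/nbhs_ballP; exists 1 => //= y;
      rewrite -ball_normE /= sub0r normrN => /ltW.
  rewrite normrM normfV ler_pdivrMl ?normr_gt0 //.
  have -> : `|h| * (`|B| * `|h|) = `|B| * h ^+ 2.
    by rewrite mulrCA -expr2 real_normK ?num_real.
  apply: le_trans (hB h h1) _.
  by rewrite ler_wpM2r ?sqr_ge0 // ler_norm.
- exact: cvg_cst.
suff : `|B| * `|h| @[h --> (0 : R)^'] --> `|B| * 0 by rewrite mulr0.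
by apply: cvgMl_tmp; apply/norm_cvg0P; exact: nbhs_dnbhs.
Unshelve. all: by end_near. Qed.

End StronglyHomogeneous.

(** * Symmetry of the coefficients and conclusion *)

Lemma swap_mono (R : realType) n (I K : {set 'I_n}) : swap (mono R I K) = mono R K I.
Proof. by apply: extP => I' K'; rewrite swapE !monoE andbC. Qed.

Lemma swapZ (R : realType) n (c : R) (u : extalg R n) : swap (c *: u) = c *: swap u.
Proof. by apply: extP => I K; rewrite swapE !extZ swapE. Qed.

Lemma card_setC_sub n p (I : {set 'I_n}) : #|I| = p -> #|~: I| = (n - p)%N.
Proof. by move=> <-; rewrite cardsCs finset.setCK card_ord. Qed.

(** On diagonal bidegrees [swap] is multiplicative and it fixes the top coefficient, so the
    normalizing signs for (I, K) and (K, I) agree. *)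
Lemma swap_hodge_mono (R : realType) n p (I K : {set 'I_n}) : #|I| = p -> #|K| = p ->
  swap (hodge_mono R I K) = hodge_mono R K I.
Proof.
move=> hI hK; have bI := @bideg_mono R n I K; have bC := @bideg_mono R n (~: I) (~: K).
rewrite hI hK in bI; rewrite !(card_setC_sub hI, card_setC_sub hK) in bC.
rewrite /hodge_mono.
have -> : volcoef (wedge (mono R K I) (mono R (~: K) (~: I))) =
    volcoef (wedge (mono R I K) (mono R (~: I) (~: K))).
  by rewrite /volcoef -!(swap_mono _ I) -!(swap_mono _ (~: I)) -(swap_wedge bI bC) swapE.
by apply: extP => A B; rewrite swapE !extZ !monoE andbC.
Qed.

Lemma test_form_hodge_mono (R : realType) n p (U : set 'rV[R]_n) (I K : {set 'I_n}) f :
  #|I| = p -> #|K| = p -> test_fun U f ->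
  test_form U (n - p) (n - p) (fun x => f x *: hodge_mono R I K).
Proof.
move=> hI hK tf; split => [x|A B].
  rewrite -{1}(card_setC_sub hI) -(card_setC_sub hK).
  by do 2 apply: bidegZ; exact: bideg_mono.
have -> : coef (fun x => f x *: hodge_mono R I K) A B =
    (fun x => hodge_mono R I K (A, B) * f x).
  by apply/funext => x; rewrite /coef extZ mulrC.
exact: test_fun_scale.
Qed.

Unset Implicit Arguments.

Theorem proposition7p6 (R : realType) (n p : nat) (Om : functional R n)
    (hp : (p <= n)%N) (hOm : strongly_homogeneous p Om) :
  strong_current (@punctured R n) p Om /\
  homogeneous_order_zero (@punctured R n) p Om.
Proof.
split; last first.
  move=> t t0 al tal; rewrite /current_scale.
  (* [current_scale] pulls test forms back by the inverse factor, which is positive and hence an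
     exponential. *)
  have -> : t^-1 = expR (ln t^-1) by rewrite lnK // posrE invr_gt0.
  exact: (current_scale_expR hp hOm).
split=> [I K hI hK f tf|al tal hal]; last first.
  apply: (current_annihilated hp hOm tal) => x a.
  (* [weakly_null (n - p)] tests against elementary forms of degree n - (n - p), which is p because
     [p <= n]. *)
  by have [_ _] := hal x; rewrite subKn.
rewrite /current_coef -(current_swap hp hOm (test_form_hodge_mono hI hK tf)).
by congr Om; apply/funext => x; rewrite swapZ (swap_hodge_mono R hI hK).
Qed.
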